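(* Let $H$ be a compact quantum group with antipode $S$ and let $S_+$ be its positive antipode. Then there exists a (convolution invertible) linear functional $\beta:H\to\mathbb{C}$ such that $S_+=(\beta\star\mathrm{id})(\mathrm{id}\star\beta^{-1})$ and $S^2=(\beta^2\star\mathrm{id})(\mathrm{id}\star\beta^{-2})$. Moreover, the restriction of $\beta$ to each simple component $H_\rho$ is unique up to multiplication by a non-zero scalar. Furthermore, one can choose the linear functional $\beta$ so that it satisfies the following additional properties: (i) $\beta=\beta S_+$ and $\beta^{-1}=\beta^{-1}S_+$; (ii) $\beta=\overline{\beta}\,\circ$, i.e. $\beta(x)=\overline{\beta(x^\circ)}$ for all $x\in H$; (iii) in the decomposition $S_+=(\beta\star\mathrm{id})(\mathrm{id}\star\beta^{-1})$ of the positive antipode, the operators $\beta\star\mathrm{id}$ and $\mathrm{id}\star\beta^{-1}$ are selfadjoint, commute with each other and leave invariant the simple components $H_\rho$ of $H$; (iv) the operators $\beta\star\mathrm{id}$ as well as $\mathrm{id}\star\beta^{-1}$ are positive.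
   Context: Everything is over $\mathbb{C}$. A $\circ$-structure on a coalgebra is a conjugate linear involution $c\mapsto c^\circ$ with $\Delta(c^\circ)=\sum c_2^\circ\otimes c_1^\circ$. A $\circ$-Hopf algebra is a Hopf algebra $H$ with a $\circ$-structure on its coalgebra such that $(xy)^\circ=x^\circ y^\circ$. A unitary inner product on a right $H$-comodule $V$ (coaction $v\mapsto\sum v_0\otimes v_1$) is an inner product (linear in the first, conjugate linear in the second variable) with $\sum\langle u_0,v\rangle u_1=\sum\langle u,v_0\rangle v_1^\circ$ for all $u,v$. A compact quantum group is a $\circ$-Hopf algebra such that every right $H$-comodule admits a unitary inner product. Such an $H$ is cosemisimple: $H=\bigoplus_{\rho}H_\rho$ with $H_\rho$ the (finite dimensional) simple subcoalgebras, called simple components; the normal integral $\varphi:H\to\mathbb{C}$ is the projection onto the component $\mathbb{C}1\cong\mathbb{C}$. The form $\langle x,y\rangle=\varphi(S(y^\circ)x)$ is an inner product on $H$; selfadjointness and positivity of operators refer to it, an operator $L$ being positive if it is selfadjoint and $\langle L(x),x\rangle>0$ for all $x\ne0$. The operator $S^2$ is positive, and the positive antipode $S_+$ is the unique positive automorphism of algebras and coalgebras of $H$ with $S_+^2=S^2$. For $\tau\in H^*$: $(\tau\star\mathrm{id})(x)=\sum\tau(x_1)x_2$ and $(\mathrm{id}\star\tau)(x)=\sum x_1\tau(x_2)$; powers and inverses of functionals are taken with respect to the convolution product of $H^*$, and $\overline{\tau}(x)=\overline{\tau(x)}$. *)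

(* Defs.v *)
From HB Require Import structures.
From mathcomp Require Import all_boot all_order all_algebra.
From mathcomp Require Import generic_quotient.
From mathcomp Require Import boolp classical_sets reals complex.

Set Implicit Arguments.
Unset Strict Implicit.
Unset Printing Implicit Defensive.
Import Order.TTheory GRing.Theory Num.Theory.
Local Open Scope ring_scope.
Local Open Scope classical_set_scope.

(* The tensor product of two modules over a commutative ring: formal sums
   [:: (u1, v1); ...; (un, vn)], two of them being identified when every
   biadditive K-balanced map takes the same value on them.  The lemmas
   tensZl ... tensBr, tsum_tens, tsumD, tsum_unique and tensor_span below give
   its usual characterization.  The target W is only a group, so that maps that
   are conjugate linear in both variables are covered as well. *)

Definition balanced (K : comNzRingType) (U V : lmodType K) (W : zmodType)
    (b : U -> V -> W) : Prop :=
  [/\ forall u1 u2 v, b (u1 + u2) v = b u1 v + b u2 v,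
      forall u v1 v2, b u (v1 + v2) = b u v1 + b u v2
    & forall a u v, b (a *: u) v = b u (a *: v)].

Definition fsum (K : comNzRingType) (U V : lmodType K) (W : zmodType)
    (b : U -> V -> W) (s : seq (U * V)) : W := \sum_(p <- s) b p.1 p.2.

Definition teq (K : comNzRingType) (U V : lmodType K)
    (s t : seq (U * V)) : bool :=
  `[< forall (W : zmodType) (b : U -> V -> W), balanced b ->
      fsum b s = fsum b t >].

Section Tensor.
Variables (K : comNzRingType) (U V : lmodType K).

Lemma teq_refl : reflexive (@teq K U V).
Proof. by move=> s; apply/asboolP. Qed.

Lemma teq_sym : symmetric (@teq K U V).
Proof.
by move=> s t; apply/idP/idP => /asboolP h; apply/asboolP => W b hb; rewrite h.
Qed.

Lemma teq_trans : transitive (@teq K U V).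
Proof.
move=> t s r /asboolP h1 /asboolP h2; apply/asboolP => W b hb.
by rewrite h1 // h2.
Qed.

Canonical teq_equiv := EquivRel (@teq K U V) teq_refl teq_sym teq_trans.

Definition tensor := {eq_quot teq_equiv}%qT.
HB.instance Definition _ := Choice.on tensor.
HB.instance Definition _ := EqQuotient.on tensor.

(* The map induced on the tensor product by b; it is only meaningful for a
   balanced b (see tsum_tens). With b u v := E, it is Sweedler's sum of E over
   t = \sum u \otimes v. *)
Definition tsum (W : zmodType) (b : U -> V -> W) (t : tensor) : W :=
  fsum b (repr t).

Lemma tsum_pi (W : zmodType) (b : U -> V -> W) s :
  balanced b -> tsum b (\pi_tensor s)%qT = fsum b s.
Proof.
move=> hb; have /eqmodP/asboolP h : (repr (\pi_tensor s) = s %[mod tensor])%qT.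
  by rewrite reprK.
exact: h.
Qed.

Lemma tensor_ext (t1 t2 : tensor) :
  (forall (W : zmodType) (b : U -> V -> W), balanced b ->
    tsum b t1 = tsum b t2) -> t1 = t2.
Proof.
move=> h; rewrite -[t1]reprK -[t2]reprK; apply/eqmodP/asboolP => W b hb.
exact: h.
Qed.

Definition tens (u : U) (v : V) : tensor := (\pi_tensor [:: (u, v)])%qT.
Definition tzero : tensor := (\pi_tensor [::])%qT.
Definition tadd (x y : tensor) : tensor := (\pi_tensor (repr x ++ repr y))%qT.
Definition tscale (a : K) (x : tensor) : tensor :=
  (\pi_tensor [seq (a *: p.1, p.2) | p <- repr x])%qT.
Definition topp (x : tensor) : tensor := tscale (-1) x.

Lemma tsum_tens (W : zmodType) (b : U -> V -> W) u v :
  balanced b -> tsum b (tens u v) = b u v.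
Proof. by move=> hb; rewrite tsum_pi // /fsum big_seq1. Qed.

Let tsum0 (W : zmodType) (b : U -> V -> W) : balanced b -> tsum b tzero = 0.
Proof. by move=> hb; rewrite tsum_pi // /fsum big_nil. Qed.

Let tsum_add (W : zmodType) (b : U -> V -> W) x y :
  balanced b -> tsum b (tadd x y) = tsum b x + tsum b y.
Proof. by move=> hb; rewrite tsum_pi // /fsum big_cat. Qed.

Let scaleb (W : zmodType) (a : K) (b : U -> V -> W) u v := b (a *: u) v.

Let balanced_scale (W : zmodType) a (b : U -> V -> W) :
  balanced b -> balanced (scaleb a b).
Proof.
rewrite /scaleb => -[h1 h2 h3]; split => [u1 u2 v|u v1 v2|c u v].
- by rewrite scalerDr h1.
- by rewrite h2.
- by rewrite scalerA mulrC -scalerA h3.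
Qed.

Let tsum_scale (W : zmodType) a (b : U -> V -> W) x :
  balanced b -> tsum b (tscale a x) = tsum (scaleb a b) x.
Proof. by move=> hb; rewrite tsum_pi // /fsum big_map. Qed.

Let taddA : associative tadd.
Proof. by move=> x y z; apply: tensor_ext => W b hb; rewrite !tsum_add // addrA. Qed.
Let taddC : commutative tadd.
Proof. by move=> x y; apply: tensor_ext => W b hb; rewrite !tsum_add // addrC. Qed.
Let tadd0 : left_id tzero tadd.
Proof. by move=> x; apply: tensor_ext => W b hb; rewrite tsum_add // tsum0 // add0r. Qed.
Let taddN : left_inverse tzero topp tadd.
Proof.
move=> x; apply: tensor_ext => W b hb.
rewrite tsum_add // tsum0 // tsum_scale // /tsum /fsum -big_split big1 //= => p _.
have [h1 _ _] := hb; rewrite /scaleb -h1 scaleN1r addNr.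
by apply: (@addrI _ (b 0 p.2)); rewrite -h1 !addr0.
Qed.

HB.instance Definition _ := GRing.isZmodule.Build tensor taddA taddC tadd0 taddN.

Lemma tsumD (W : zmodType) (b : U -> V -> W) (x y : tensor) :
  balanced b -> tsum b (x + y) = tsum b x + tsum b y.
Proof. exact: tsum_add. Qed.

Let tscaleA a c x : tscale a (tscale c x) = tscale (a * c) x.
Proof.
apply: tensor_ext => W b hb; rewrite !tsum_scale //; last exact: balanced_scale.
by rewrite /tsum /fsum /scaleb; apply: eq_bigr => p _; rewrite scalerA mulrC.
Qed.
Let tscale1 : left_id 1 tscale.
Proof.
move=> x; apply: tensor_ext => W b hb; rewrite tsum_scale //.
by rewrite /tsum /fsum /scaleb; apply: eq_bigr => p _; rewrite scale1r.
Qed.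
Let tscaleDr : right_distributive tscale +%R.
Proof.
move=> a x y; apply: tensor_ext => W b hb.
by rewrite !(tsumD, tsum_scale) //; exact: balanced_scale.
Qed.
Let tscaleDl x : {morph tscale^~ x : a c / a + c}.
Proof.
move=> a c; apply: tensor_ext => W b hb; rewrite !(tsumD, tsum_scale) //.
rewrite /tsum /fsum /scaleb -big_split /=; apply: eq_bigr => p _.
by have [h1 _ _] := hb; rewrite scalerDl h1.
Qed.

HB.instance Definition _ :=
  GRing.Zmodule_isLmodule.Build K tensor tscaleA tscale1 tscaleDr tscaleDl.

Lemma tensZl a u v : tens (a *: u) v = a *: tens u v.
Proof.
apply: tensor_ext => W b hb.
by rewrite tsum_tens // tsum_scale // tsum_tens //; exact: balanced_scale.
Qed.

Lemma tensZr a u v : tens u (a *: v) = a *: tens u v.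
Proof.
rewrite -tensZl; apply: tensor_ext => W b hb.
by rewrite !tsum_tens //; have [_ _ h3] := hb; rewrite h3.
Qed.

Lemma tensDl u1 u2 v : tens (u1 + u2) v = tens u1 v + tens u2 v.
Proof.
by apply: tensor_ext => W b hb; rewrite tsumD // !tsum_tens //; have [h1 _ _] := hb; rewrite h1.
Qed.

Lemma tensDr u v1 v2 : tens u (v1 + v2) = tens u v1 + tens u v2.
Proof.
by apply: tensor_ext => W b hb; rewrite tsumD // !tsum_tens //; have [_ h2 _] := hb; rewrite h2.
Qed.

Lemma balanced_tens : balanced tens.
Proof.
by split=> *; rewrite ?tensDl ?tensDr ?tensZl ?tensZr.
Qed.

Lemma tensor_span (t : tensor) :
  exists s : seq (U * V), t = \sum_(p <- s) tens p.1 p.2.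
Proof.
exists (repr t); apply: tensor_ext => W b hb.
have -> : tsum b (\sum_(p <- repr t) tens p.1 p.2)
   = \sum_(p <- repr t) tsum b (tens p.1 p.2).
  by elim/big_rec2: _ => [|p y1 y2 _ <-]; [exact: tsum0 | rewrite tsumD].
by apply: eq_bigr => p _; rewrite tsum_tens.
Qed.

Lemma tsumZ (W : lmodType K) (b : U -> V -> W) (a : K) (t : tensor) :
  balanced b -> (forall u v, b (a *: u) v = a *: b u v) ->
  tsum b (a *: t) = a *: tsum b t.
Proof.
move=> hb hl; rewrite tsum_scale // /tsum /fsum scaler_sumr.
by apply: eq_bigr => p _; exact: hl.
Qed.

Lemma tsum_unique (W : zmodType) (b : U -> V -> W) (f : {additive tensor -> W}) :
  balanced b -> (forall u v, f (tens u v) = b u v) -> f =1 tsum b.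
Proof.
move=> hb hf t; have [s ->] := tensor_span t.
rewrite raddf_sum; elim: s => [|p s IH]; first by rewrite !big_nil tsum0.
by rewrite !big_cons tsumD // IH tsum_tens // hf.
Qed.

End Tensor.

Notation "x ⊗ y" := (tens x y) (at level 40, left associativity) : ring_scope.

Definition tmap (K : comNzRingType) (U V U' V' : lmodType K)
    (f : U -> U') (g : V -> V') : tensor U V -> tensor U' V' :=
  tsum (fun u v => f u ⊗ g v).

Definition tassoc (K : comNzRingType) (U V W : lmodType K) :
    tensor (tensor U V) W -> tensor U (tensor V W) :=
  tsum (fun t w => tsum (fun u v => u ⊗ (v ⊗ w)) t).

Definition tmul (K : comNzRingType) (A : algType K) (s t : tensor A A) :
    tensor A A :=
  tsum (fun a b => tsum (fun c d => (a * c) ⊗ (b * d)) t) s.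

HB.mixin Record isCoalgebra (K : fieldType) C of GRing.Lmodule K C := {
  comul : {linear C -> tensor C C};
  counit : {scalar C};
  comulA : forall x, tassoc (tmap comul idfun (comul x))
                     = tmap idfun comul (comul x);
  counitl : forall x, tsum (fun x1 x2 => counit x1 *: x2) (comul x) = x;
  counitr : forall x, tsum (fun x1 x2 => counit x2 *: x1) (comul x) = x
}.
#[short(type="coalgType")]
HB.structure Definition Coalgebra (K : fieldType) :=
  {C of isCoalgebra K C & GRing.Lmodule K C}.

HB.mixin Record isHopf (K : fieldType) H of GRing.Algebra K H & Coalgebra K H
  := {
  comulM : forall x y : H, comul (x * y) = tmul (comul x) (comul y);
  comul1 : comul (1 : H) = 1 ⊗ 1;
  counitM : forall x y : H, counit (x * y) = counit x * counit y;
  counit1 : counit (1 : H) = 1;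
  antipode : {linear H -> H};
  antipodel : forall x,
    tsum (fun x1 x2 => antipode x1 * x2) (comul x) = (counit x)%:A;
  antipoder : forall x,
    tsum (fun x1 x2 => x1 * antipode x2) (comul x) = (counit x)%:A
}.
#[short(type="hopfType")]
HB.structure Definition Hopf (K : fieldType) :=
  {H of isHopf K H & GRing.Algebra K H & Coalgebra K H}.

HB.mixin Record hasCirc (K : numClosedFieldType) C of Coalgebra K C := {
  circ : C -> C;
  circD : forall x y, circ (x + y) = circ x + circ y;
  circZ : forall (a : K) x, circ (a *: x) = a^* *: circ x;
  circK : forall x, circ (circ x) = x;
  comul_circ : forall x, comul (circ x)
                 = tsum (fun x1 x2 => circ x2 ⊗ circ x1) (comul x)
}.
#[short(type="circCoalgType")]
HB.structure Definition CircCoalgebra (K : numClosedFieldType) :=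
  {C of hasCirc K C & Coalgebra K C}.

HB.mixin Record isCircHopf (K : numClosedFieldType) H
    of Hopf K H & CircCoalgebra K H := {
  circM : forall x y : H, circ (x * y) = circ x * circ y
}.
#[short(type="circHopfType")]
HB.structure Definition CircHopf (K : numClosedFieldType) :=
  {H of isCircHopf K H & Hopf K H & CircCoalgebra K H}.

Definition right_comodule (K : fieldType) (C : coalgType K) (V : lmodType K)
    (rho : {linear V -> tensor V C}) : Prop :=
  (forall v, tassoc (tmap rho idfun (rho v)) = tmap idfun comul (rho v)) /\
  (forall v, tsum (fun v0 v1 => counit v1 *: v0) (rho v) = v).

Definition inner_product (K : numClosedFieldType) (V : lmodType K)
    (f : V -> V -> K) : Prop :=
  [/\ forall v, scalar (f^~ v),
      forall u v, f v u = (f u v)^*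
    & forall v, v != 0 -> 0 < f v v].

Definition unitary (K : numClosedFieldType) (C : circCoalgType K)
    (V : lmodType K) (rho : {linear V -> tensor V C}) (f : V -> V -> K) : Prop :=
  forall u v, tsum (fun u0 u1 => f u0 v *: u1) (rho u)
            = tsum (fun v0 v1 => f u v0 *: circ v1) (rho v).

HB.mixin Record isCompactQuantumGroup (K : numClosedFieldType) H
    of CircHopf K H := {
  unitarizable : forall (V : lmodType K) (rho : {linear V -> tensor V H}),
    right_comodule rho -> exists f, inner_product f /\ unitary rho f
}.
#[short(type="cqgType")]
HB.structure Definition CompactQuantumGroup (K : numClosedFieldType) :=
  {H of isCompactQuantumGroup K H & CircHopf K H}.

Definition subspace (K : fieldType) (V : lmodType K) (D : set V) : Prop :=
  D 0 /\ forall (a : K) u v, D u -> D v -> D (a *: u + v).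

Definition subcoalgebra (K : fieldType) (C : coalgType K) (D : set C) : Prop :=
  subspace D /\
  forall x, D x -> exists s : seq (C * C),
    (forall p, p \in s -> D p.1 /\ D p.2) /\
    comul x = \sum_(p <- s) p.1 ⊗ p.2.

Definition simple_subcoalgebra (K : fieldType) (C : coalgType K) (D : set C)
    : Prop :=
  [/\ subcoalgebra D, D <> [set 0]
    & forall E : set C, subcoalgebra E -> E `<=` D -> E = [set 0] \/ E = D].

(* The projection of the direct sum of the simple components onto the component
   K 1 (identified with K) along the sum of the other ones. *)
Definition normal_integral (K : fieldType) (H : hopfType K) (phi : {scalar H})
    : Prop :=
  phi 1 = 1 /\
  forall D : set H, simple_subcoalgebra D -> D <> range (fun a : K => a%:A : H) ->
    forall x, D x -> phi x = 0.

Definition hform (K : numClosedFieldType) (H : circHopfType K)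
    (phi : {scalar H}) (x y : H) : K := phi (antipode (circ y) * x).

Definition selfadjoint (K : numClosedFieldType) (H : circHopfType K)
    (phi : {scalar H}) (L : H -> H) : Prop :=
  forall x y, hform phi (L x) y = hform phi x (L y).

Definition positive_op (K : numClosedFieldType) (H : circHopfType K)
    (phi : {scalar H}) (L : H -> H) : Prop :=
  selfadjoint phi L /\ forall x, x != 0 -> 0 < hform phi (L x) x.

Definition coalgebra_morphism (K : fieldType) (C D : coalgType K) (f : C -> D)
    : Prop :=
  (forall x, comul (f x) = tmap f f (comul x)) /\
  (forall x, counit (f x) = counit x).

Definition positive_antipode (K : numClosedFieldType) (H : circHopfType K)
    (phi : {scalar H}) (Sp : {lrmorphism H -> H}) : Prop :=
  [/\ bijective Sp, coalgebra_morphism Sp, positive_op phi Sp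
    & forall x, Sp (Sp x) = antipode (antipode x)].

(* convl tau is tau ⋆ id and convr tau is id ⋆ tau. *)
Definition convl (K : fieldType) (C : coalgType K) (tau : C -> K) (x : C) : C :=
  tsum (fun x1 x2 => tau x1 *: x2) (comul x).

Definition convr (K : fieldType) (C : coalgType K) (tau : C -> K) (x : C) : C :=
  tsum (fun x1 x2 => tau x2 *: x1) (comul x).

Definition conv (K : fieldType) (C : coalgType K) (sigma tau : C -> K) (x : C)
    : K :=
  tsum (fun x1 x2 => sigma x1 * tau x2) (comul x).

Definition conv_inverse (K : fieldType) (C : coalgType K) (tau tauV : C -> K)
    : Prop :=
  (forall x, conv tau tauV x = counit x) /\
  (forall x, conv tauV tau x = counit x).

Definition decomposes_antipode (K : fieldType) (H : hopfType K)
    (Sp : H -> H) (beta betaV : H -> K) : Prop :=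
  [/\ conv_inverse beta betaV,
      forall x, Sp x = convl beta (convr betaV x)
    & forall x, antipode (antipode x)
              = convl (conv beta beta) (convr (conv betaV betaV) x)].

(* Main.v *)
Require Import Defs.
From HB Require Import structures.
From mathcomp Require Import all_boot all_order all_algebra.
From mathcomp Require Import ring.
From mathcomp Require Import boolp classical_sets reals complex.
Set Implicit Arguments.
Unset Strict Implicit.
Unset Printing Implicit Defensive.
Import Order.TTheory GRing.Theory Num.Theory.
Local Open Scope ring_scope.

(* The regular comodule H carries a unitary inner product f, so H is spanned by
   the entries of irreducible unitary matrix corepresentations u, those with
   u_ij° = u_ji and a scalar commutant.  Both f and the form <x, y> of the
   integral satisfy T u = v T for T_lj = F(u_ij, v_kl) with i, k fixed, hence
   Schur's lemma gives the orthogonality relations, and with them that the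
   simple components are the spans of the irreducible u.  As x, y |-> <S_+ x, y>
   is positive definite, its Gram matrix T on a row of u is positive definite
   and T S_+(u) = u T; diagonalizing T by a unitary matrix gives
   S_+(u_ij) = (b_i / b_j) u_ij with b_i > 0, and beta(u_ij) = b_i delta_ij.
   Then beta * id and id * beta^-1 multiply u_ij by b_i and 1 / b_j; they are
   positive because their square roots (for b^(1/2)) are selfadjoint.
   Uniqueness is Schur's lemma again. *)

(** * Matrices with entries in a module *)

(** Positivity is given only for [hform phi (Sp x) x]; that [hform phi] itself is hermitian or
    positive definite is not a hypothesis. Hence two forms work side by side. The unitary inner
    product [f] supplies nondegeneracy: dual bases for the entries of an irreducible u, and with
    them functionals with prescribed values. The form of the integral enters through its
    intertwining relation and through S_+ being a positive operator; its twist by S_+ is hermitian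
    by polarization. Positivity of <y, y> comes out only at the end: the operator N multiplying u_ij
    by (b_i / b_j)^(1/2) is a selfadjoint bijective square root of S_+, so <y, y> = <S_+ z, z> with
    N z = y. A common positive factor in the b_i of one component changes neither the quotients b_i
    / b_j nor any sign; this is the freedom that uniqueness leaves, so no normalization is chosen.
    As there may be infinitely many components, beta is assembled from its restrictions through [f]:
    each x is orthogonal to all but finitely many components. *)

Section ScalarMatrices.
Variable K : comNzRingType.

(** Entries of a corepresentation lie in a coalgebra, which has no product; scalar matrices act on
    them from both sides, and [tmx] replaces the product of two such matrices, so that
    corepresentations and intertwiners become matrix identities. *)
Definition lact (V : lmodType K) m n p (X : 'M[K]_(m, n)) (w : 'M[V]_(n, p)) :
  'M[V]_(m, p) := \matrix_(i, k) \sum_j X i j *: w j k.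
Definition ract (V : lmodType K) m n p (w : 'M[V]_(m, n)) (X : 'M[K]_(n, p)) :
  'M[V]_(m, p) := \matrix_(i, k) \sum_j X j k *: w i j.
Definition tmx (U V : lmodType K) m n p (u : 'M[U]_(m, n)) (v : 'M[V]_(n, p)) :
  'M[tensor U V]_(m, p) := \matrix_(i, k) \sum_j u i j ⊗ v j k.

Section OneModule.
Variable V : lmodType K.

Lemma lactA m n p q (X : 'M[K]_(m, n)) (Y : 'M_(n, p)) (w : 'M[V]_(p, q)) :
  lact X (lact Y w) = lact (X *m Y) w.
Proof.
apply/matrixP => i k; rewrite !mxE.
under eq_bigr => j _ do rewrite mxE scaler_sumr.
rewrite exchange_big /=; apply: eq_bigr => l _; rewrite mxE scaler_suml.
by apply: eq_bigr => j _; rewrite scalerA.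
Qed.

Lemma ractA m n p q (w : 'M[V]_(m, n)) (X : 'M[K]_(n, p)) (Y : 'M_(p, q)) :
  ract (ract w X) Y = ract w (X *m Y).
Proof.
apply/matrixP => i k; rewrite !mxE.
under eq_bigr => j _ do rewrite mxE scaler_sumr.
rewrite exchange_big /=; apply: eq_bigr => l _; rewrite mxE scaler_suml.
by apply: eq_bigr => j _; rewrite scalerA mulrC.
Qed.

Lemma lact_ract m n p q (X : 'M[K]_(m, n)) (w : 'M[V]_(n, p)) (Y : 'M_(p, q)) :
  lact X (ract w Y) = ract (lact X w) Y.
Proof.
apply/matrixP => i k; rewrite !mxE.
under eq_bigr => j _ do rewrite mxE scaler_sumr.
rewrite exchange_big /=; apply: eq_bigr => l _; rewrite mxE scaler_sumr.
by apply: eq_bigr => j _; rewrite !scalerA mulrC.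
Qed.

Lemma lact_scalar n p a (w : 'M[V]_(n, p)) :
  lact a%:M w = \matrix_(i, k) (a *: w i k).
Proof.
apply/matrixP => i k; rewrite !mxE (bigD1 i) //= big1 => [|j /negPf jni].
  by rewrite mxE eqxx addr0.
by rewrite mxE eq_sym jni scale0r.
Qed.

Lemma ract_scalar m n a (w : 'M[V]_(m, n)) :
  ract w a%:M = \matrix_(i, k) (a *: w i k).
Proof.
apply/matrixP => i k; rewrite !mxE (bigD1 k) //= big1 => [|j /negPf jni].
  by rewrite mxE eqxx addr0.
by rewrite mxE jni scale0r.
Qed.

Lemma lact1 n p (w : 'M[V]_(n, p)) : lact 1%:M w = w.
Proof. by rewrite lact_scalar; apply/matrixP => i k; rewrite mxE scale1r. Qed.

Lemma ract1 m n (w : 'M[V]_(m, n)) : ract w 1%:M = w.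
Proof. by rewrite ract_scalar; apply/matrixP => i k; rewrite mxE scale1r. Qed.

Lemma tr_lact m n p (X : 'M[K]_(m, n)) (w : 'M[V]_(n, p)) :
  (lact X w)^T = ract w^T X^T.
Proof.
by apply/matrixP => i k; rewrite !mxE; apply: eq_bigr => j _; rewrite !mxE.
Qed.

Lemma tr_ract m n p (w : 'M[V]_(m, n)) (X : 'M[K]_(n, p)) :
  (ract w X)^T = lact X^T w^T.
Proof.
by apply/matrixP => i k; rewrite !mxE; apply: eq_bigr => j _; rewrite !mxE.
Qed.

Lemma lactDl m n p (X Y : 'M[K]_(m, n)) (w : 'M[V]_(n, p)) :
  lact (X + Y) w = lact X w + lact Y w.
Proof.
apply/matrixP => i k; rewrite !mxE -big_split.
by apply: eq_bigr => j _; rewrite mxE scalerDl.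
Qed.

Lemma ractDr m n p (w : 'M[V]_(m, n)) (X Y : 'M[K]_(n, p)) :
  ract w (X + Y) = ract w X + ract w Y.
Proof.
apply/matrixP => i k; rewrite !mxE -big_split.
by apply: eq_bigr => j _; rewrite mxE scalerDl.
Qed.

Lemma lactZl m n p a (X : 'M[K]_(m, n)) (w : 'M[V]_(n, p)) :
  lact (a *: X) w = \matrix_(i, k) (a *: lact X w i k).
Proof. by rewrite -mul_scalar_mx -lactA lact_scalar. Qed.

Lemma ractZr m n p a (w : 'M[V]_(m, n)) (X : 'M[K]_(n, p)) :
  ract w (a *: X) = \matrix_(i, k) (a *: ract w X i k).
Proof. by rewrite -mul_mx_scalar -ractA ract_scalar. Qed.

End OneModule.

Lemma map_lact (U V : lmodType K) (g : {linear U -> V}) m n p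
    (X : 'M[K]_(m, n)) (w : 'M[U]_(n, p)) :
  map_mx g (lact X w) = lact X (map_mx g w).
Proof.
apply/matrixP => i k; rewrite !mxE linear_sum.
by apply: eq_bigr => j _; rewrite linearZ mxE.
Qed.

Lemma map_ract (U V : lmodType K) (g : {linear U -> V}) m n p
    (w : 'M[U]_(m, n)) (X : 'M[K]_(n, p)) :
  map_mx g (ract w X) = ract (map_mx g w) X.
Proof.
apply/matrixP => i k; rewrite !mxE linear_sum.
by apply: eq_bigr => j _; rewrite linearZ mxE.
Qed.

Lemma map_lact_scalar (U : lmodType K) (g : {scalar U}) m n p
    (X : 'M[K]_(m, n)) (w : 'M[U]_(n, p)) :
  map_mx g (lact X w) = X *m map_mx g w.
Proof.
apply/matrixP => i k; rewrite !mxE linear_sum.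
by apply: eq_bigr => j _; rewrite linearZ mxE.
Qed.

Lemma map_ract_scalar (U : lmodType K) (g : {scalar U}) m n p
    (w : 'M[U]_(m, n)) (X : 'M[K]_(n, p)) :
  map_mx g (ract w X) = map_mx g w *m X.
Proof.
apply/matrixP => i k; rewrite !mxE linear_sum.
by apply: eq_bigr => j _; rewrite linearZ mxE /= mulrC.
Qed.

Section Tensors.
Variables U V : lmodType K.

Fact tens0l (v : V) : (0 : U) ⊗ v = 0.
Proof. by rewrite -(scale0r 0) tensZl scale0r. Qed.

Fact tens0r (u : U) : u ⊗ (0 : V) = 0.
Proof. by rewrite -(scale0r 0) tensZr scale0r. Qed.

Lemma tens_suml I (r : seq I) (P : pred I) (F : I -> U) (v : V) :
  (\sum_(i <- r | P i) F i) ⊗ v = \sum_(i <- r | P i) F i ⊗ v.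
Proof.
by apply: (big_morph (fun u => u ⊗ v)) => [x y|]; rewrite ?tensDl ?tens0l.
Qed.

Lemma tens_sumr I (r : seq I) (P : pred I) (F : I -> V) (u : U) :
  u ⊗ (\sum_(i <- r | P i) F i) = \sum_(i <- r | P i) u ⊗ F i.
Proof. by apply: big_morph => [x y|]; rewrite ?tensDr ?tens0r. Qed.

Lemma tmx_lact m n p q (X : 'M[K]_(m, n)) (u : 'M[U]_(n, p)) (v : 'M[V]_(p, q)) :
  tmx (lact X u) v = lact X (tmx u v).
Proof.
apply/matrixP => i k; rewrite !mxE.
under eq_bigr => j _ do rewrite mxE tens_suml.
rewrite exchange_big /=; apply: eq_bigr => l _; rewrite mxE scaler_sumr.
by apply: eq_bigr => j _; rewrite tensZl.
Qed.

Lemma tmx_ract m n p q (u : 'M[U]_(m, n)) (v : 'M[V]_(n, p)) (X : 'M[K]_(p, q)) :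
  tmx u (ract v X) = ract (tmx u v) X.
Proof.
apply/matrixP => i k; rewrite !mxE.
under eq_bigr => j _ do rewrite mxE tens_sumr.
rewrite exchange_big /=; apply: eq_bigr => l _; rewrite mxE scaler_sumr.
by apply: eq_bigr => j _; rewrite tensZr.
Qed.

Lemma tmx_mid m n p q (u : 'M[U]_(m, n)) (X : 'M[K]_(n, p)) (v : 'M[V]_(p, q)) :
  tmx (ract u X) v = tmx u (lact X v).
Proof.
apply/matrixP => i k; rewrite !mxE.
under eq_bigr => j _ do rewrite mxE tens_suml.
rewrite exchange_big /=; apply: eq_bigr => l _; rewrite mxE tens_sumr.
by apply: eq_bigr => j _; rewrite tensZl tensZr.
Qed.

Lemma tsum_sum (W : zmodType) (b : U -> V -> W) I (r : seq I) (P : pred I)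
    (F : I -> tensor U V) : balanced b ->
  tsum b (\sum_(i <- r | P i) F i) = \sum_(i <- r | P i) tsum b (F i).
Proof.
move=> hb; apply: big_morph => [x y|]; first exact: tsumD.
by apply: (@addrI _ (tsum b 0)); rewrite -tsumD // !addr0.
Qed.

Lemma tsum_sum_tens (W : zmodType) (b : U -> V -> W) I (r : seq I) (P : pred I)
    (F : I -> U) (G : I -> V) : balanced b ->
  tsum b (\sum_(i <- r | P i) F i ⊗ G i) = \sum_(i <- r | P i) b (F i) (G i).
Proof.
by move=> hb; rewrite tsum_sum //; apply: eq_bigr => i _; rewrite tsum_tens.
Qed.

Lemma balanced_scalel (W : lmodType K) (t : {scalar U}) (g : {linear V -> W}) :
  balanced (fun u v => t u *: g v).
Proof.
split=> [u1 u2 v|u v1 v2|a u v]; first by rewrite linearD scalerDl.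
  by rewrite linearD scalerDr.
by rewrite !linearZ /= scalerA mulrC.
Qed.

Lemma balanced_scaler (W : lmodType K) (t : {scalar V}) (g : {linear U -> W}) :
  balanced (fun u v => t v *: g u).
Proof.
split=> [u1 u2 v|u v1 v2|a u v]; first by rewrite linearD scalerDr.
  by rewrite linearD scalerDl.
by rewrite !linearZ /= scalerA mulrC.
Qed.

Lemma balanced_map (U' V' : lmodType K) (g : {linear U -> U'})
    (k : {linear V -> V'}) : balanced (fun u v => g u ⊗ k v).
Proof.
by split=> *; rewrite ?linearD ?linearZ ?tensDl ?tensDr ?tensZl ?tensZr.
Qed.

End Tensors.

End ScalarMatrices.

(** The proof of linearity is an argument, so that the instance below can recover it; a function
    proved linear afterwards thus becomes a [{scalar V}], to which the lemmas on [convl] and [convr]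
    apply. *)
Definition scalar_of (K : comNzRingType) (V : lmodType K) (g : V -> K)
  of scalar g : V -> K := g.
HB.instance Definition _ (K : comNzRingType) (V : lmodType K) (g : V -> K)
  (hg : scalar g) := GRing.isLinear.Build K V K *%R (scalar_of hg) hg.

(** * Convolution operators on a coalgebra *)

Section Coassociativity.
Variables (K : fieldType) (C : coalgType K).

Fact balanced_assoc_inner (U V W : lmodType K) (w : W) :
  balanced (fun (u : U) (v : V) => u ⊗ (v ⊗ w)).
Proof. by split=> *; rewrite ?tensDl ?tensDr // tensZl -tensZr tensZl. Qed.

Fact balanced_assoc (U V W : lmodType K) :
  balanced (fun (t : tensor U V) (w : W) => tsum (fun u v => u ⊗ (v ⊗ w)) t).
Proof.
split=> [t1 t2 w|t w1 w2|a t w].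
- by rewrite tsumD //; exact: balanced_assoc_inner.
- rewrite /tsum /fsum -big_split; apply: eq_bigr => p _.
  by rewrite !tensDr.
- rewrite tsumZ; [|exact: balanced_assoc_inner|by move=> *; rewrite tensZl].
  rewrite /tsum /fsum scaler_sumr; apply: eq_bigr => p _.
  by rewrite !tensZr.
Qed.

Lemma tassoc_tens (U V W : lmodType K) (u : U) (v : V) (w : W) :
  tassoc ((u ⊗ v) ⊗ w) = u ⊗ (v ⊗ w).
Proof.
rewrite /tassoc tsum_tens; last exact: balanced_assoc.
by rewrite tsum_tens //; exact: balanced_assoc_inner.
Qed.

Lemma balanced_tsum_r (U V W T : lmodType K) (b : V -> W -> T) : balanced b ->
  (forall a v w, b (a *: v) w = a *: b v w) ->
  balanced (fun (u : U) (t : tensor V W) => u ⊗ tsum b t).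
Proof.
by move=> hb hZ; split=> *; rewrite ?tsumD ?tensDl ?tensDr ?tsumZ ?tensZl ?tensZr.
Qed.

Lemma convrE (tau : {scalar C}) x I (r : seq I) (a b : I -> C) :
  comul x = \sum_(i <- r) a i ⊗ b i ->
  convr tau x = \sum_(i <- r) tau (b i) *: a i.
Proof.
move=> hx; rewrite /convr hx tsum_sum_tens //.
exact: (balanced_scaler tau idfun).
Qed.

Lemma convlE (tau : {scalar C}) x I (r : seq I) (a b : I -> C) :
  comul x = \sum_(i <- r) a i ⊗ b i ->
  convl tau x = \sum_(i <- r) tau (a i) *: b i.
Proof.
move=> hx; rewrite /convl hx tsum_sum_tens //.
exact: (balanced_scalel tau idfun).
Qed.

Lemma convr_linear (tau : {scalar C}) : linear (convr tau).
Proof.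
move=> a x y; rewrite /convr linearP tsumD ?tsumZ //;
  try exact: (balanced_scaler tau idfun).
by move=> *; rewrite !scalerA mulrC.
Qed.

Lemma convl_linear (tau : {scalar C}) : linear (convl tau).
Proof.
move=> a x y; rewrite /convl linearP tsumD ?tsumZ //;
  try exact: (balanced_scalel tau idfun).
by move=> *; rewrite linearZ scalerA.
Qed.

HB.instance Definition _ (tau : {scalar C}) :=
  GRing.isLinear.Build K C C *:%R (convr tau) (convr_linear tau).
HB.instance Definition _ (tau : {scalar C}) :=
  GRing.isLinear.Build K C C *:%R (convl tau) (convl_linear tau).

Lemma comul_span (x : C) :
  exists s : seq (C * C), comul x = \sum_(p <- s) p.1 ⊗ p.2.
Proof. exact: tensor_span. Qed.

Lemma coassoc (x : C) I (r : seq I) (a b : I -> C) :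
  comul x = \sum_(i <- r) a i ⊗ b i ->
  \sum_(i <- r) tassoc (comul (a i) ⊗ b i) = \sum_(i <- r) a i ⊗ comul (b i).
Proof.
move=> hx; have := comulA x; rewrite hx /tmap.
rewrite [in RHS]tsum_sum_tens; last exact: (balanced_map idfun comul).
move=> <-; rewrite /= tsum_sum_tens; last exact: (balanced_map comul idfun).
by rewrite /tassoc tsum_sum //; exact: balanced_assoc.
Qed.

(** Apply [tau] to the last leg of the coassociativity identity. *)
Lemma comul_convr (tau : {scalar C}) x I (r : seq I) (a b : I -> C) :
  comul x = \sum_(i <- r) a i ⊗ b i ->
  comul (convr tau x) = \sum_(i <- r) a i ⊗ convr tau (b i).
Proof.
move=> hx; pose ctr := tsum (fun v w : C => tau w *: v).
have hb : balanced (fun v w : C => tau w *: v).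
  exact: (balanced_scaler tau idfun).
have hZ c (v w : C) : tau w *: (c *: v) = c *: (tau w *: v).
  by rewrite !scalerA mulrC.
have hc := balanced_tsum_r C hb hZ.
have := congr1 (tsum (fun (u : C) t => u ⊗ ctr t)) (coassoc hx).
rewrite tsum_sum // tsum_sum_tens // => <-.
rewrite (convrE _ hx) linear_sum; apply: eq_bigr => i _.
have [s hs] := comul_span (a i); rewrite linearZ /= hs tens_suml.
rewrite /tassoc tsum_sum; last exact: balanced_assoc.
rewrite tsum_sum // scaler_sumr; apply: eq_bigr => p _.
by rewrite [X in tsum _ X]tassoc_tens tsum_tens // /ctr tsum_tens // tensZr.
Qed.

(** Apply [tau] to the first leg of the coassociativity identity. *)
Lemma comul_convl (tau : {scalar C}) x I (r : seq I) (a b : I -> C) :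
  comul x = \sum_(i <- r) a i ⊗ b i ->
  comul (convl tau x) = \sum_(i <- r) convl tau (a i) ⊗ b i.
Proof.
move=> hx.
have hc := balanced_scalel tau (idfun : {linear tensor C C -> tensor C C}).
have := congr1 (tsum (fun (u : C) t => tau u *: idfun t)) (coassoc hx).
rewrite tsum_sum // tsum_sum_tens // => h.
rewrite (convlE _ hx) linear_sum /=.
under eq_bigr => i _ do rewrite linearZ /=.
rewrite -[LHS]h; apply: eq_bigr => i _.
have [s hs] := comul_span (a i); rewrite hs (convlE _ hs) !tens_suml.
rewrite /tassoc tsum_sum; last exact: balanced_assoc.
rewrite tsum_sum //; apply: eq_bigr => p _.
by rewrite [X in tsum _ X]tassoc_tens tsum_tens // tensZl.
Qed.

Lemma counit_sumr x I (r : seq I) (a b : I -> C) :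
  comul x = \sum_(i <- r) a i ⊗ b i -> x = \sum_(i <- r) counit (b i) *: a i.
Proof. by move=> hx; rewrite -[LHS]counitr; exact: convrE. Qed.

Lemma counit_suml x I (r : seq I) (a b : I -> C) :
  comul x = \sum_(i <- r) a i ⊗ b i -> x = \sum_(i <- r) counit (a i) *: b i.
Proof. by move=> hx; rewrite -[LHS]counitl; exact: convlE. Qed.

Lemma counit_convl (tau : {scalar C}) x : counit (convl tau x) = tau x.
Proof.
have [s hs] := comul_span x.
rewrite (convlE _ hs) [in RHS](counit_sumr hs) !linear_sum.
apply: eq_bigr => p _.
by rewrite !linearZ /= mulrC.
Qed.

Lemma counit_convr (tau : {scalar C}) x : counit (convr tau x) = tau x.
Proof.
have [s hs] := comul_span x.
rewrite (convrE _ hs) [in RHS](counit_suml hs) !linear_sum.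
by apply: eq_bigr => p _; rewrite !linearZ /= mulrC.
Qed.

Lemma subspaceD (V : lmodType K) (D : set V) u v :
  subspace D -> D u -> D v -> D (u + v).
Proof. by move=> [_ h] hu hv; rewrite -[u]scale1r; exact: h. Qed.

Lemma subspaceZ (V : lmodType K) (D : set V) a u :
  subspace D -> D u -> D (a *: u).
Proof. by move=> [h0 h] hu; rewrite -[_ *: _]addr0; exact: h. Qed.

Lemma subspace_sum (V : lmodType K) (D : set V) I (r : seq I) (P : pred I)
    (F : I -> V) : subspace D -> (forall i, P i -> D (F i)) ->
  D (\sum_(i <- r | P i) F i).
Proof.
move=> hD hF; elim/big_rec: _ => [|i x /hF hi hx]; first by case: hD.
exact: subspaceD.
Qed.

Lemma subcoalgebra_convr (D : set C) (tau : {scalar C}) x :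
  subcoalgebra D -> D x -> D (convr tau x).
Proof.
move=> [hD hc] /hc[s [hs hx]]; rewrite (convrE _ hx) big_seq.
by apply: subspace_sum => // p /hs[h1 h2]; exact: subspaceZ.
Qed.

Lemma subcoalgebra_convl (D : set C) (tau : {scalar C}) x :
  subcoalgebra D -> D x -> D (convl tau x).
Proof.
move=> [hD hc] /hc[s [hs hx]]; rewrite (convlE _ hx) big_seq.
by apply: subspace_sum => // p /hs[h1 h2]; exact: subspaceZ.
Qed.

End Coassociativity.

(** * Unitary corepresentations *)

Definition corep (K : fieldType) (C : coalgType K) n (u : 'M[C]_n) : Prop :=
  map_mx comul u = tmx u u /\ map_mx counit u = 1%:M.

Definition ucorep (K : numClosedFieldType) (C : circCoalgType K) n
    (u : 'M[C]_n) : Prop :=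
  corep u /\ map_mx circ u = u^T.

Lemma corep_comul (K : fieldType) (C : coalgType K) n (u : 'M[C]_n) i j :
  corep u -> comul (u i j) = \sum_k u i k ⊗ u k j.
Proof. by move=> [/matrixP/(_ i j)]; rewrite !mxE. Qed.

Lemma corep_counit (K : fieldType) (C : coalgType K) n (u : 'M[C]_n) i j :
  corep u -> counit (u i j) = (i == j)%:R.
Proof. by move=> [_ /matrixP/(_ i j)]; rewrite !mxE. Qed.

Lemma ucorep_circ (K : numClosedFieldType) (C : circCoalgType K) n
    (u : 'M[C]_n) i j : ucorep u -> circ (u i j) = u j i.
Proof. by move=> [_ /matrixP/(_ i j)]; rewrite !mxE. Qed.

(** * Sesquilinear forms and orthonormalization *)

Section Sesquilinear.
Variables (K : numClosedFieldType) (V : lmodType K).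

Definition sesquilinear (F : V -> V -> K) : Prop :=
  (forall v, scalar (F^~ v)) /\
  (forall u a v w, F u (a *: v + w) = a^* * F u v + F u w).

Variable F : V -> V -> K.
Hypothesis hF : sesquilinear F.

Lemma sesquiDl u v w : F (u + v) w = F u w + F v w.
Proof. by rewrite -{1}[u]scale1r hF.1 mul1r. Qed.
Lemma sesqui0l w : F 0 w = 0.
Proof. by apply: (@addrI _ (F 0 w)); rewrite -sesquiDl !addr0. Qed.
Lemma sesquiZl a v w : F (a *: v) w = a * F v w.
Proof. by rewrite -[_ *: v]addr0 hF.1 sesqui0l addr0. Qed.
Lemma sesquiDr u v w : F u (v + w) = F u v + F u w.
Proof. by rewrite -{1}[v]scale1r hF.2 rmorph1 mul1r. Qed.
Lemma sesqui0r w : F w 0 = 0.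
Proof. by apply: (@addrI _ (F w 0)); rewrite -sesquiDr !addr0. Qed.
Lemma sesquiZr a v w : F w (a *: v) = a^* * F w v.
Proof. by rewrite -[_ *: v]addr0 hF.2 sesqui0r addr0. Qed.
Lemma sesqui_suml I (r : seq I) (P : pred I) (G : I -> V) w :
  F (\sum_(i <- r | P i) G i) w = \sum_(i <- r | P i) F (G i) w.
Proof.
by apply: (big_morph (F^~ w)) => [x y|]; rewrite ?sesquiDl ?sesqui0l.
Qed.
Lemma sesqui_sumr I (r : seq I) (P : pred I) (G : I -> V) w :
  F w (\sum_(i <- r | P i) G i) = \sum_(i <- r | P i) F w (G i).
Proof. by apply: big_morph => [x y|]; rewrite ?sesquiDr ?sesqui0r. Qed.

End Sesquilinear.

Section InnerProduct.
Variables (K : numClosedFieldType) (V : lmodType K) (f : V -> V -> K).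
Hypothesis hf : inner_product f.

Lemma inner_product_sesquilinear : sesquilinear f.
Proof.
have [h1 h2 _] := hf; split=> // u a v w.
by rewrite h2 h1 rmorphD rmorphM /= -!h2.
Qed.
Let sf := inner_product_sesquilinear.

Definition inner_scalar v : {scalar V} := scalar_of (sf.1 v).
Arguments inner_scalar : simpl never.

Lemma inner_scalarE v u : inner_scalar v u = f u v.
Proof. by []. Qed.

Lemma inner_product_eq0 v : f v v = 0 -> v = 0.
Proof.
have [_ _ h] := hf => hv; apply/eqP/negPn/negP => /h.
by rewrite hv ltxx.
Qed.

Definition orthonormal (e : seq V) : Prop :=
  forall i j, (i < size e)%N -> (j < size e)%N -> f e`_i e`_j = (i == j)%:R.

Lemma orthonormal_coord (e : seq V) (c : V -> K) j :
  orthonormal e -> (j < size e)%N ->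
  f (\sum_(b <- e) c b *: b) e`_j = c e`_j.
Proof.
move=> he hj; rewrite (big_nth 0) big_mkord sesqui_suml //.
rewrite (bigD1 (Ordinal hj)) //= sesquiZl // he // eqxx mulr1.
rewrite big1 ?addr0 // => i /negPf ij; rewrite sesquiZl // he //.
by rewrite -val_eqE /= in ij; rewrite ij mulr0.
Qed.

(** That [e] lies in the span of [a] is stated as membership in every subspace containing [a]. A
    vector already in the span of the vectors treated before it contributes nothing to [e]. *)
Lemma gram_schmidt (a : seq V) : exists e : seq V,
  [/\ orthonormal e,
      forall P : set V, subspace P -> (forall y, y \in a -> P y) ->
        forall y, y \in e -> P y
    & forall y, y \in a -> y = \sum_(b <- e) f y b *: b].
Proof.
elim: a => [|y a [e [he1 he2 he3]]]; first by exists [::].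
pose x := y - \sum_(b <- e) f y b *: b.
have hP P : subspace P -> (forall z, z \in y :: a -> P z) ->
    forall z, z \in e -> P z.
  by move=> hP hz; apply: he2 => // z hza; apply: hz; rewrite inE hza orbT.
have [/eqP|x0] := eqVneq x 0.
  rewrite subr_eq0 => /eqP hy; exists e; split=> // z.
  by rewrite inE => /predU1P[->|/he3].
have [_ fC fpos] := hf; have fx0 := fpos _ x0.
pose c := sqrtC (f x x).
have c0 : c != 0 by rewrite sqrtC_eq0 gt_eqF.
have hxe j : (j < size e)%N -> f x e`_j = 0.
  move=> hj; rewrite /x -scaleN1r sesquiDl // sesquiZl //.
  by rewrite orthonormal_coord // mulN1r subrr.
(* [y - x] lies in the span of [e], to which [x] is orthogonal. *)
have fyx : f y x = f x x.
  have -> : y = x + \sum_(b <- e) f y b *: b by rewrite subrK.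
  rewrite sesquiDl // (_ : f (\sum_(b <- e) _) _ = 0) ?addr0 //.
  rewrite sesqui_suml // (big_nth 0) big_mkord big1 // => i _.
  by rewrite sesquiZl // [f _ x]fC hxe // conjC0 mulr0.
exists (rcons e (c^-1 *: x)); split=> [i j|P hsP hz z|z].
- rewrite size_rcons !ltnS !nth_rcons => hi hj.
  have [hi'|hi'] := ltnP i (size e); have [hj'|hj'] := ltnP j (size e).
  + exact: he1.
  + have -> : j = size e by apply/eqP; rewrite eqn_leq hj.
    rewrite eqxx sesquiZr // [f _ x]fC hxe // conjC0 mulr0.
    by rewrite ltn_eqF.
  + have -> : i = size e by apply/eqP; rewrite eqn_leq hi.
    by rewrite eqxx sesquiZl // hxe // mulr0 gtn_eqF.
  + have -> : j = size e by apply/eqP; rewrite eqn_leq hj.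
    have -> : i = size e by apply/eqP; rewrite eqn_leq hi.
    rewrite !eqxx sesquiZl // sesquiZr // geC0_conj ?invr_ge0 ?sqrtC_ge0 1?ltW //.
    by rewrite mulrA -invfM -expr2 sqrtCK mulVf // gt_eqF.
- rewrite mem_rcons inE => /predU1P[->|]; last exact: hP.
  apply: subspaceZ => //; rewrite /x -scaleN1r; apply: subspaceD => //.
    by apply: hz; rewrite mem_head.
  apply: subspaceZ => //; rewrite big_seq; apply: subspace_sum => // b hb.
  by apply: subspaceZ => //; exact: hP.
- rewrite big_rcons /= inE => /predU1P[->|hz]; last first.
    rewrite {1}(he3 _ hz) [X in _ = _ + X](_ : _ = 0) ?addr0 //.
    rewrite sesquiZr // {1}(he3 _ hz) sesqui_suml // (big_nth 0) big_mkord big1 ?mulr0 ?scale0r //.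
    by move=> i _; rewrite sesquiZl // [f _ x]fC hxe // conjC0 mulr0.
  rewrite [X in _ = _ + X](_ : _ = x); first by rewrite addrC subrK.
  rewrite scalerA sesquiZr // geC0_conj ?invr_ge0 ?sqrtC_ge0 1?ltW // fyx.
  by rewrite mulrC mulrA -invfM -expr2 sqrtCK mulVf ?scale1r // gt_eqF.
Qed.

End InnerProduct.
Arguments inner_scalar : simpl never.

Section UnitaryCoreps.
Variables (K : numClosedFieldType) (C : circCoalgType K) (f : C -> C -> K).
Hypotheses (hf : inner_product f) (uf : unitary (@comul K C) f).
Let sf := inner_product_sesquilinear hf.

Let fl := inner_scalar hf.

Lemma unitaryE u v I (r : seq I) (a b : I -> C) J (s : seq J) (c d : J -> C) :
  comul u = \sum_(i <- r) a i ⊗ b i -> comul v = \sum_(j <- s) c j ⊗ d j ->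
  \sum_(i <- r) f (a i) v *: b i = \sum_(j <- s) f u (c j) *: circ (d j).
Proof.
move=> hu hv; have := uf u v; rewrite hu hv !tsum_sum_tens //.
- split=> [v1 v2 w|w v1 v2|z v1 v2]; first by rewrite sesquiDr // scalerDl.
    by rewrite circD scalerDr.
  by rewrite sesquiZr // circZ scalerA mulrC.
- exact: (balanced_scalel (fl v) idfun).
Qed.

(** Once the second legs of the coproduct of x are orthonormalized, the first legs are the
    [convr (fl y) x]; their span is a finite dimensional right subcomodule containing x. In an
    orthonormal basis [e] of it the coaction has matrix [u], and unitarity of [f] says that
    [circ (u i j) = u j i]. *)
Lemma ucorep_exists (x : C) : exists n (u : 'M[C]_n) (c : 'M[K]_n),
  ucorep u /\ x = \sum_i \sum_j c i j *: u i j.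
Proof.
have [s hs] := comul_span x.
have [b [hb _ hsb]] := gram_schmidt hf [seq p.2 | p <- s].
have hx : comul x = \sum_(y <- b) convr (fl y) x ⊗ y.
  under eq_bigr => y _ do rewrite (convrE _ hs) tens_suml.
  rewrite exchange_big /= hs [LHS]big_seq [RHS]big_seq.
  apply: eq_bigr => p hp; rewrite {1}(hsb p.2); last exact: map_f.
  by rewrite tens_sumr; apply: eq_bigr => y _; rewrite tensZl tensZr.
have [e [he heP hea]] := gram_schmidt hf [seq convr (fl y) x | y <- b].
(* [P y] says that the coproduct of [y] has its first legs in the span of [e]; the second legs are
   then read off by pairing with [e]. *)
pose P : set C := fun y => comul y = \sum_(z <- e) z ⊗ convl (fl z) y.
have hP : subspace P.
  split=> [|a y1 y2 h1 h2]; rewrite /P /=.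
    by rewrite linear0 big1 // => z _; rewrite linear0 tens0r.
  rewrite linearP h1 h2 scaler_sumr -big_split; apply: eq_bigr => z _.
  by rewrite linearP tensDr tensZr.
have heP' y : y \in e -> comul y = \sum_(z <- e) z ⊗ convl (fl z) y.
  move: y; apply: heP => // _ /mapP[y hy ->].
  have hc : comul (convr (fl y) x) = \sum_(z <- b) convr (fl z) x ⊗ convr (fl y) z.
    exact: comul_convr.
  rewrite /P /= hc.
  under [RHS]eq_bigr => z _ do rewrite (convlE _ hc) tens_sumr.
  rewrite exchange_big /= [LHS]big_seq [RHS]big_seq.
  apply: eq_bigr => z hz; rewrite {1}(hea (convr (fl z) x)); last exact: map_f.
  by rewrite tens_suml; apply: eq_bigr => t _; rewrite tensZl tensZr.
pose n := size e; pose u : 'M[C]_n := \matrix_(i, j) convl (fl e`_i) e`_j.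
have hu (j : 'I_n) : comul e`_j = \sum_(i < n) e`_i ⊗ u i j.
  rewrite heP' ?mem_nth // (big_nth 0) big_mkord.
  by apply: eq_bigr => i _; rewrite mxE.
have hue : ucorep u.
  split; [split|]; apply/matrixP => i j; rewrite !mxE.
  - by rewrite (comul_convl _ (hu j)); apply: eq_bigr => k _; rewrite !mxE.
  - by rewrite counit_convl inner_scalarE he // eq_sym.
  - have := unitaryE (hu i) (hu j).
    rewrite (bigD1 j) //= he // eqxx scale1r big1 ?addr0 => [|k /negPf kj].
      rewrite (bigD1 i) //= he // eqxx scale1r big1 ?addr0 => [|k /negPf ki].
        by rewrite !mxE.
      by rewrite he // val_eqE eq_sym ki scale0r.
    by rewrite he // val_eqE kj scale0r.
exists n, u; exists (\matrix_(i, j) (counit e`_i * f x e`_j)); split=> //.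
(* The counit on second legs puts [x] in the span of [e]; the counit on the first legs of the
   coaction then expands each basis vector in the entries of [u]. *)
have hxe : x = \sum_(z <- e) f x z *: z.
  rewrite {1}(counit_sumr hx) {2}(counit_sumr hx).
  under [RHS]eq_bigr => z _ do rewrite sesqui_suml // scaler_suml.
  rewrite exchange_big /= [LHS]big_seq [RHS]big_seq.
  apply: eq_bigr => z hz; rewrite {1}(hea (convr (fl z) x)); last exact: map_f.
  by rewrite scaler_sumr; apply: eq_bigr => t _; rewrite sesquiZl // scalerA.
rewrite {1}hxe (big_nth 0) big_mkord.
under eq_bigr => j _ do rewrite {2}(counit_suml (hu j)) scaler_sumr.
rewrite exchange_big /=; apply: eq_bigr => i _; apply: eq_bigr => j _.
by rewrite !mxE scalerA mulrC.
Qed.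

End UnitaryCoreps.

(** * Decomposition into irreducible corepresentations *)

Local Open Scope sesquilinear_scope.

(** For unitary corepresentations a scalar commutant amounts to irreducibility, and it is the form
    in which Schur's lemma uses it. The empty matrix satisfies it too, whence the sizes [n.+1]
    below. *)
Definition irr (K : comNzRingType) (V : lmodType K) n (u : 'M[V]_n) : Prop :=
  forall X : 'M[K]_n, lact X u = ract u X -> exists c, X = c%:M.

Section Decomposition.
Import Num.Def.
Variables (K : numClosedFieldType) (C : circCoalgType K).

Lemma map_circ_lact m n p (X : 'M[K]_(m, n)) (w : 'M[C]_(n, p)) :
  map_mx circ (lact X w) = lact (map_mx conjC X) (map_mx circ w).
Proof.
apply/matrixP => i k; rewrite !mxE (big_morph circ (@circD _ C) (id1 := 0)).
  by apply: eq_bigr => j _; rewrite circZ !mxE.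
by apply: (@addrI _ (circ 0)); rewrite -circD !addr0.
Qed.

Lemma map_circ_ract m n p (w : 'M[C]_(m, n)) (X : 'M[K]_(n, p)) :
  map_mx circ (ract w X) = ract (map_mx circ w) (map_mx conjC X).
Proof.
apply: trmx_inj; rewrite tr_ract map_trmx tr_ract map_circ_lact.
by rewrite !map_trmx.
Qed.

Lemma unitarymxV n (Q : 'M[K]_n) : Q \is unitarymx -> Q ^t* *m Q = 1%:M.
Proof. by move=> /unitarymxP h; exact: mulmx1C. Qed.

Lemma ucorep_conj n (u : 'M[C]_n) (Q : 'M[K]_n) : Q \is unitarymx ->
  ucorep u -> ucorep (lact Q (ract u (Q ^t* ))).
Proof.
move=> hQ [[h1 h2] h3]; have hQ' := unitarymxV hQ; split; [split|].
- rewrite map_lact map_ract h1 tmx_lact tmx_mid.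
  by rewrite lactA hQ' lact1 tmx_ract.
- rewrite map_lact_scalar map_ract_scalar h2 mul1mx; exact/unitarymxP.
- rewrite map_circ_lact map_circ_ract h3 tr_lact tr_ract -lact_ract.
  rewrite map_trmx trmxK -!map_trmx -map_mx_comp.
  by rewrite (map_mx_id (f := conjC \o conjC) (@conjCK K)).
Qed.

(** Apply the involution and transpose: a unitary [u] is returned unchanged, while the scalars are
    conjugated. *)
Lemma intertwiner_star m n (u : 'M[C]_n) (v : 'M[C]_m) (T : 'M[K]_(m, n)) :
  ucorep u -> ucorep v ->
  lact T u = ract v T -> lact (T ^t* ) v = ract u (T ^t* ).
Proof.
move=> [_ hu] [_ hv] /(congr1 (fun w => (map_mx circ w)^T)).
by rewrite map_circ_lact map_circ_ract hu hv tr_lact tr_ract !trmxK !map_trmx.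
Qed.

(** The commutant is closed under the adjoint, so it contains the hermitian part of a nonscalar [X]
    and i times its antihermitian part, and these cannot both be scalar. *)
Lemma not_irr_hermitian n (u : 'M[C]_n) : ucorep u -> ~ irr u ->
  exists Y : 'M[K]_n, [/\ lact Y u = ract u Y, Y ^t* = Y &
    ~ exists c, Y = c%:M].
Proof.
move=> hu /existsNP[X /not_implyP[hX nX]].
have hXs := intertwiner_star hu hu hX.
have [[c hc]|h1] := pselect (exists c, X + X ^t* = c%:M); last first.
  exists (X + X ^t*); split=> //; first by rewrite lactDl ractDr hX hXs.
  by rewrite linearD /= map_mxD trmxCK addrC.
have [[d hd]|h2] := pselect (exists d, 'i *: (X - X ^t*) = d%:M); last first.
  exists ('i *: (X - X ^t*)); split=> //.
    by rewrite -[- _]scaleN1r !(lactZl, ractZr, lactDl, ractDr) hX hXs.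
  by rewrite linearZ linearB /= map_mxZ map_mxB trmxCK /= conjCi scaleNr -scalerN opprB.
(* If both were scalar, c and d, solving for [X] would give this scalar. *)
case: nX; exists (2^-1 * (c - 'i * d)).
rewrite -scale_scalar_mx raddfB /= -scale_scalar_mx -hc -hd scalerA -expr2 sqrCi.
rewrite scaleN1r opprK addrACA subrr addr0 -mulr2n -scaler_nat scalerA.
by rewrite mulVf ?scale1r // pnatr_eq0.
Qed.

Lemma irr_star_mul m n (u : 'M[C]_n) (v : 'M[C]_m) (T : 'M[K]_(m, n)) :
  ucorep u -> ucorep v -> irr u -> lact T u = ract v T ->
  exists a, T ^t* *m T = a%:M.
Proof.
move=> hu hv iu hT; apply: iu.
by rewrite -lactA hT lact_ract (intertwiner_star hu hv hT) ractA.
Qed.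

Lemma star_mul_eq0 m n (T : 'M[K]_(m, n)) : T ^t* *m T = 0 -> T = 0.
Proof.
move=> h; apply/matrixP => i j; rewrite mxE.
have /matrixP/(_ j j) := h; rewrite !mxE => /eqP.
rewrite psumr_eq0 => [/allP/(_ i (mem_index_enum _))|k _].
  by rewrite !mxE mulrC mul_conjC_eq0 => /eqP.
by rewrite !mxE mulrC mul_conjC_ge0.
Qed.

(** Both products lie in a commutant and are scalars. The two scalars agree because each of them
    times [T] is the triple product of [T], its adjoint and [T]; the value 0 would force [T = 0]. *)
Lemma schur m n (u : 'M[C]_n) (v : 'M[C]_m) (T : 'M[K]_(m, n)) :
  ucorep u -> ucorep v -> irr u -> irr v -> lact T u = ract v T -> T != 0 ->
  exists2 a, a != 0 & T ^t* *m T = a%:M /\ T *m T ^t* = a%:M.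
Proof.
move=> hu hv iu iv hT T0.
have [a ha] := irr_star_mul hu hv iu hT.
have [b] := irr_star_mul hv hu iv (intertwiner_star hu hv hT).
rewrite trmxCK => hb; exists a.
  apply: contra_neq T0 => a0; apply: star_mul_eq0.
  by rewrite ha a0 raddf0.
split=> //; rewrite hb; congr _%:M; apply/eqP; rewrite -subr_eq0.
have : (b - a) *: T = 0.
  by rewrite scalerBl -mul_scalar_mx -hb -mul_mx_scalar -ha mulmxA subrr.
by move/eqP; rewrite scaler_eq0 (negPf T0) orbF.
Qed.

Variable P : set C.
Hypothesis hP : subspace P.

Lemma subspace_lact n p m (X : 'M[K]_(m, n)) (w : 'M[C]_(n, p)) :
  (forall i j, P (w i j)) -> forall i j, P (lact X w i j).
Proof.
move=> h i j; rewrite mxE; apply: subspace_sum => // k _.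
exact: subspaceZ.
Qed.

Lemma subspace_ract n p m (X : 'M[K]_(n, p)) (w : 'M[C]_(m, n)) :
  (forall i j, P (w i j)) -> forall i j, P (ract w X i j).
Proof.
move=> h i j; rewrite mxE; apply: subspace_sum => // k _.
exact: subspaceZ.
Qed.

Hypothesis irrP : forall n (u : 'M[C]_n), ucorep u -> irr u ->
  forall i j, P (u i j).

(** Complete reducibility as an induction on the size: in an eigenbasis of a nonscalar hermitian
    intertwiner, [u] splits into one block for each eigenvalue, all of smaller size. *)
Lemma ucorep_ind n (u : 'M[C]_n) : ucorep u -> forall i j, P (u i j).
Proof.
have [k] := ubnP n; elim: k n u => // k IH n u hnk hu.
have [|/(not_irr_hermitian hu)[Y [hY Yh Yns]]] := pselect (irr u).
  exact: irrP.
have /orthomx_spectralP : Y \is normalmx.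
  by apply/normalmxP; rewrite Yh.
set Q := spectralmx Y; set d := spectral_diag Y => Ydiag.
have hQ : Q \is unitarymx by exact: spectral_unitarymx.
have QV := unitarymxV hQ; have /unitarymxP QQ := hQ.
rewrite invmx_unitary // in Ydiag.
pose v := lact Q (ract u (Q ^t* )).
have hv : ucorep v by exact: ucorep_conj.
have hdv : lact (diag_mx d) v = ract v (diag_mx d).
  have -> : diag_mx d = Q *m Y *m Q ^t*.
    by rewrite Ydiag !mulmxA QQ mul1mx -mulmxA QQ mulmx1.
  rewrite /v lactA -!mulmxA QV mulmx1 -lact_ract ractA !mulmxA QV mul1mx.
  by rewrite -!lactA -!ractA; congr lact; rewrite lact_ract hY.
have uE : u = lact (Q ^t* ) (ract v Q).
  by rewrite /v -lact_ract ractA QV ract1 lactA QV lact1.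
move: v hv hdv uE => v hv hdv uE.
(* Commuting with the diagonal matrix means (d_i - d_j) v_ij = 0. *)
have v0 i j : d 0 i != d 0 j -> v i j = 0.
  move=> dij; have /matrixP/(_ i j) := hdv; rewrite !mxE.
  rewrite (bigD1 i) //= big1 => [|l /negPf li]; last first.
    by rewrite mxE eq_sym li mulr0n scale0r.
  rewrite (bigD1 j) //= big1 => [|l /negPf li]; last first.
    by rewrite mxE li mulr0n scale0r.
  rewrite !addr0 !mxE !eqxx !mulr1n => /eqP; rewrite -subr_eq0 -scalerBl.
  by rewrite scaler_eq0 subr_eq0 (negPf dij) => /eqP.
have hvP i j : P (v i j).
  have [dij|/v0 ->] := eqVneq (d 0 i) (d 0 j); last by case: hP.
  (* The block of one eigenvalue; it is proper, since otherwise [Y] would be scalar. *)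
  pose I := [set l | d 0 l == d 0 i].
  have hI : (#|I| < k)%N.
    apply: (@leq_trans n) => //; rewrite -[X in (_ < X)%N]card_ord -cardsT.
    apply: proper_card; rewrite properT; apply/negP => /eqP hI.
    apply: Yns; exists (d 0 i); rewrite Ydiag.
    have -> : diag_mx d = (d 0 i)%:M.
      apply/matrixP => a b; rewrite !mxE.
      have : a \in I by rewrite hI inE.
      by rewrite inE => /eqP ->.
    by rewrite -mulmxA mul_scalar_mx -scalemxAr QV scalemx1.
  pose w : 'M[C]_#|I| := \matrix_(a, b) v (enum_val a) (enum_val b).
  have hw : ucorep w.
    split; [split|]; apply/matrixP => a b; rewrite !mxE.
    - rewrite (corep_comul _ _ hv.1) (bigID (mem I)) /= addrC big1 ?add0r.
        rewrite big_enum_val; apply: eq_bigr => c _; by rewrite !mxE.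
      move=> l; rewrite inE => hl; rewrite v0 ?tens0l //.
      have := enum_valP a; rewrite inE => /eqP ->; by rewrite eq_sym.
    - by rewrite (corep_counit _ _ hv.1) (inj_eq enum_val_inj).
    - by rewrite (ucorep_circ _ _ hv).
  have iI : i \in I by rewrite inE.
  have jI : j \in I by rewrite inE dij.
  have := IH _ w hI hw (enum_rank_in iI i) (enum_rank_in iI j).
  by rewrite mxE !enum_rankK_in.
rewrite uE; by apply: subspace_lact; apply: subspace_ract.
Qed.

End Decomposition.

(** * Schur orthogonality and simple subcoalgebras *)

Definition mxspan (K : comNzRingType) (V : lmodType K) n (u : 'M[V]_n) : set V :=
  fun x => exists c : 'M[K]_n, x = \sum_i \sum_j c i j *: u i j.

Section MatrixSpan.
Variables (K : fieldType) (V : lmodType K).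

Lemma mxspan_subspace n (u : 'M[V]_n) : subspace (mxspan u).
Proof.
split=> [|a x y [c ->] [d ->]].
  by exists 0; rewrite big1 // => i _; rewrite big1 // => j _; rewrite mxE scale0r.
exists (a *: c + d); rewrite scaler_sumr -big_split; apply: eq_bigr => i _.
rewrite scaler_sumr -big_split; apply: eq_bigr => j _.
by rewrite !mxE scalerDl scalerA.
Qed.

Lemma mxspan_entry n (u : 'M[V]_n) i j : mxspan u (u i j).
Proof.
exists (delta_mx i j); rewrite (bigD1 i) //= [X in X + _](bigD1 j) //=.
rewrite mxE !eqxx scale1r big1 ?big1 ?addr0 // => [k /negPf ki|k /negPf ki].
  by rewrite big1 // => l _; rewrite mxE ki scale0r.
by rewrite mxE ki andbF scale0r.
Qed.

Lemma mxspan_min n (u : 'M[V]_n) (D : set V) x :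
  subspace D -> (forall i j, D (u i j)) -> mxspan u x -> D x.
Proof.
move=> hD hu [c ->]; apply: subspace_sum => // i _.
by apply: subspace_sum => // j _; exact: subspaceZ.
Qed.

Lemma linear_mxsum (W : lmodType K) (g : {linear V -> W}) n (c : 'M[K]_n)
    (w : 'I_n -> 'I_n -> V) :
  g (\sum_i \sum_j c i j *: w i j) = \sum_i \sum_j c i j *: g (w i j).
Proof.
rewrite linear_sum; apply: eq_bigr => i _.
by rewrite linear_sum; apply: eq_bigr => j _; rewrite linearZ.
Qed.

End MatrixSpan.

Section Orthogonality.
Variables (K : numClosedFieldType) (C : circCoalgType K).

(** What the inner product [f] and the form of the integral have in common, isolated so that
    orthogonality is proved once for both. *)
Definition intertwining (F : C -> C -> K) n m (u : 'M[C]_n) (v : 'M[C]_m) :=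
  forall i k, let T := \matrix_(l, j) F (u i j) (v k l) in
    lact T u = ract v T.

(** By Schur's lemma a nonzero [T] is a multiple of a unitary matrix, so [u] and [v] would be
    conjugate and span the same space. *)
Lemma intertwining_orth (F : C -> C -> K) n m (u : 'M[C]_n) (v : 'M[C]_m) :
  ucorep u -> ucorep v -> irr u -> irr v -> intertwining F u v ->
  mxspan u <> mxspan v -> forall i j k l, F (u i j) (v k l) = 0.
Proof.
move=> hu hv iu iv hF uv i j k l; have /= hT := hF i k.
set T := \matrix_(_, _) _ in hT; have [T0|] := eqVneq T 0.
  by have /matrixP/(_ l j) := T0; rewrite !mxE.
move=> /(schur hu hv iu iv hT)[a a0 [h1 h2]]; case: uv.
have vE : v = ract (lact T u) (a^-1 *: (T ^t* )).
  by rewrite hT ractA -scalemxAr h2 -mul_scalar_mx -scalar_mxM mulVf // ract1.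
have uE : u = lact (a^-1 *: (T ^t* )) (ract v T).
  by rewrite -hT lactA -scalemxAl h1 -mul_scalar_mx -scalar_mxM mulVf // lact1.
have su := mxspan_subspace u; have sv := mxspan_subspace v.
apply/seteqP; split=> x; apply: mxspan_min => // p0 q0.
  rewrite uE; apply: subspace_lact => // p q; apply: subspace_ract => //.
  exact: mxspan_entry.
rewrite vE; apply: subspace_ract => // p q; apply: subspace_lact => //.
exact: mxspan_entry.
Qed.

Lemma intertwining_diag (F : C -> C -> K) n (u : 'M[C]_n) :
  irr u -> intertwining F u u ->
  forall i k, exists c, forall j l, F (u i j) (u k l) = c *+ (j == l).
Proof.
move=> iu hF i k; have [c hc] := iu _ (hF i k); exists c => j l.
by have /matrixP/(_ l j) := hc; rewrite !mxE eq_sym.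
Qed.

Variable f : C -> C -> K.
Hypotheses (hf : inner_product f) (uf : unitary (@comul K C) f).
Let sf := inner_product_sesquilinear hf.
Let fl := inner_scalar hf.

Lemma unitary_intertwining n m (u : 'M[C]_n) (v : 'M[C]_m) :
  ucorep u -> ucorep v -> intertwining f u v.
Proof.
move=> hu hv i k; apply/matrixP => l j; rewrite !mxE.
under eq_bigr => p _ do rewrite mxE.
under [RHS]eq_bigr => p _ do rewrite mxE -(ucorep_circ p l hv).
exact: (unitaryE hf uf (corep_comul i j hu.1) (corep_comul k l hv.1)).
Qed.

Lemma convl_corep (tau : {scalar C}) n (u : 'M[C]_n) i j : corep u ->
  convl tau (u i j) = \sum_k tau (u i k) *: u k j.
Proof. by move=> hu; exact: convlE (corep_comul _ _ hu). Qed.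

Lemma convr_corep (tau : {scalar C}) n (u : 'M[C]_n) i j : corep u ->
  convr tau (u i j) = \sum_k tau (u k j) *: u i k.
Proof. by move=> hu; exact: convrE (corep_comul _ _ hu). Qed.

(** By orthogonality the Gram matrix of the entries is the Kronecker product of [g] with the
    identity, so it suffices to invert [g]. The dual basis also shows that the entries of [u] are
    linearly independent. *)
Lemma irr_dual n (u : 'M[C]_n) : ucorep u -> irr u ->
  exists z : 'M[C]_n, (forall a b, mxspan u (z a b)) /\
    forall i j a b, f (u i j) (z a b) = ((i == a) && (j == b))%:R.
Proof.
case: n u => [u _ _|n u hu iu]; first by exists u; split=> [[]|[]].
pose g : 'M[K]_n.+1 := \matrix_(i, k) f (u i ord0) (u k ord0).
have gE i j k l : f (u i j) (u k l) = g i k *+ (j == l).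
  have [c hc] := intertwining_diag iu (unitary_intertwining hu hu) i k.
  by rewrite mxE !hc eqxx.
have gu : g \in unitmx.
  rewrite unitmxE unitfE; apply/negP => /det0P[w w0 wg].
  case/eqP: w0; apply/rowP => j; rewrite mxE.
  (* If [w] is killed by [g], this element has norm 0; its counit is [w 0 j], which therefore
     vanishes. *)
  pose y := \sum_i w 0 i *: u i j.
  have y0 : y = 0.
    apply: (inner_product_eq0 hf); rewrite {2}/y sesqui_sumr // big1 // => k _.
    rewrite sesquiZr // sesqui_suml // [X in _ * X](_ : _ = (w *m g) 0 k).
      by rewrite wg mxE mulr0.
    rewrite mxE; apply: eq_bigr => i _.
    by rewrite sesquiZl // gE eqxx.
  have := congr1 counit y0; rewrite linear0 linear_sum => <-.
  rewrite (bigD1 j) //= linearZ /= (corep_counit _ _ hu.1) eqxx mulr1.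
  rewrite big1 ?addr0 // => k /negPf kj.
  by rewrite linearZ /= (corep_counit _ _ hu.1) kj mulr0.
exists (\matrix_(a, b) \sum_k (invmx g k a)^* *: u k b); split=> [a b|i j a b].
  rewrite mxE; apply: subspace_sum => [|k _]; first exact: mxspan_subspace.
  by apply: subspaceZ; [exact: mxspan_subspace|exact: mxspan_entry].
have := mulmxV gu => /matrixP/(_ i a); rewrite mxE [in RHS]mxE => h.
rewrite [in LHS]mxE sesqui_sumr // -mulnb natrM -h mulr_suml; apply: eq_bigr => k _.
by rewrite sesquiZr // conjCK gE mulrC mulr_natr mulrnAl.
Qed.

(** Convolving on both sides with dual basis functionals acts like multiplication by matrix units:
    one entry is carried to u_ab and all others to 0. A nonzero coefficient of [x] thus isolates
    u_ab, and subcoalgebras are stable under convolution. *)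
Lemma irr_sub_subcoalgebra n (u : 'M[C]_n) (E : set C) x :
  ucorep u -> irr u -> subcoalgebra E -> E x -> mxspan u x -> x != 0 ->
  forall i j, E (u i j).
Proof.
move=> hu iu hE Ex [c xE] x0 a b; have [z [_ hz]] := irr_dual hu iu.
have [i0 [j0 c0]] : exists i j, c i j != 0.
  apply: contrapT => h; case/eqP: x0; rewrite xE big1 // => i _.
  rewrite big1 // => j _; have [->|cij] := eqVneq (c i j) 0.
    by rewrite scale0r.
  by case: h; exists i, j.
pose L := convl (fl (z i0 a)); pose R := convr (fl (z b j0)).
have LR i j : L (R (u i j)) = ((i == i0) && (j == j0))%:R *: u a b.
  rewrite /R (convr_corep _ _ _ hu.1) (bigD1 b) //= big1 => [|k /negPf kb].
    rewrite addr0 /L linearZ inner_scalarE hz eqxx /= (convl_corep _ _ _ hu.1).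
    rewrite (bigD1 a) //= big1 => [|k /negPf ka].
      by rewrite addr0 inner_scalarE hz eqxx andbT scalerA -natrM mulnb andbC.
    by rewrite inner_scalarE hz ka andbF scale0r.
  by rewrite inner_scalarE hz kb scale0r.
have LRx : L (R x) = c i0 j0 *: u a b.
  have -> : L (R x) = \sum_i \sum_j c i j *: L (R (u i j)).
    rewrite xE /R (linear_mxsum (convr _)).
    exact: (linear_mxsum (convl _) c (fun i j => R (u i j))).
  rewrite (bigD1 i0) //= [X in _ + X]big1 ?addr0 => [|i /negPf ii0].
    rewrite (bigD1 j0) //= LR !eqxx scale1r big1 ?addr0 // => j /negPf jj0.
    by rewrite LR jj0 andbF scale0r scaler0.
  by rewrite big1 // => j _; rewrite LR ii0 scale0r scaler0.
have -> : u a b = (c i0 j0)^-1 *: L (R x).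
  by rewrite LRx scalerA mulVf // scale1r.
apply: subspaceZ; first by case: hE.
by apply: subcoalgebra_convl => //; exact: subcoalgebra_convr.
Qed.

Lemma mxspan_subcoalgebra n (u : 'M[C]_n) : corep u -> subcoalgebra (mxspan u).
Proof.
move=> hu; split=> [|x]; first exact: mxspan_subspace.
have hs := mxspan_subspace u.
pose D : set C := fun x => exists s : seq (C * C),
    (forall p, p \in s -> mxspan u p.1 /\ mxspan u p.2) /\
    comul x = \sum_(p <- s) p.1 ⊗ p.2.
apply: (@mxspan_min _ _ _ _ D) => [|i j]; last first.
  exists [seq (u i k, u k j) | k <- index_enum 'I_n]; split.
    by move=> p /mapP[k _ ->]; split; exact: mxspan_entry.
  by rewrite big_map /= (corep_comul _ _ hu).
split=> [|a y1 y2 [s1 [h1 e1]] [s2 [h2 e2]]].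
  by exists [::]; split=> //; rewrite big_nil linear0.
exists ([seq (a *: p.1, p.2) | p <- s1] ++ s2); split.
  move=> p; rewrite mem_cat => /orP[/mapP[q /h1[q1 q2] ->]|/h2//].
  by split=> //; exact: subspaceZ.
rewrite linearP e1 e2 big_cat big_map scaler_sumr; congr (_ + _).
by apply: eq_bigr => p _; rewrite tensZl.
Qed.

Lemma corep_neq0 n (u : 'M[C]_n) i : corep u -> u i i != 0.
Proof.
move=> hu; apply/eqP => /(congr1 counit)/eqP.
by rewrite (corep_counit _ _ hu) eqxx linear0 oner_eq0.
Qed.

Lemma irr_simple n (u : 'M[C]_n.+1) :
  ucorep u -> irr u -> simple_subcoalgebra (mxspan u).
Proof.
move=> hu iu; split=> [|h|E hE Eu].
- exact: mxspan_subcoalgebra hu.1.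
- have := mxspan_entry u ord0 ord0; rewrite h => /= h0.
  by have := corep_neq0 ord0 hu.1; rewrite h0 eqxx.
- have [h|/existsNP[x /not_implyP[Ex /eqP x0]]] := pselect (forall x, E x -> x = 0).
    left; apply/seteqP; split=> x; first by move/h.
    by move=> /= ->; case: hE => -[].
  right; apply/seteqP; split=> // y; apply: mxspan_min => [|i j].
    by case: hE.
  by apply: (irr_sub_subcoalgebra hu iu hE Ex) => //; exact: Eu.
Qed.

Lemma irr_ind (P : set C) : subspace P ->
  (forall n (u : 'M[C]_n.+1), ucorep u -> irr u -> forall i j, P (u i j)) ->
  forall x, P x.
Proof.
move=> hP h x; have [n [u [c [hu ->]]]] := ucorep_exists hf uf x.
apply: subspace_sum => // i _; apply: subspace_sum => // j _.
apply: subspaceZ => //; apply: ucorep_ind => // -[u' _ _ []//|]; exact: h.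
Qed.

(** A nonzero element of [D] pairs nontrivially with an entry of some irreducible [u]. Convolving it
    with that entry stays in [D], lands in the span of [u], and is nonzero because its counit is the
    pairing; so [D] contains the whole span. *)
Lemma simple_irr (D : set C) : simple_subcoalgebra D ->
  exists n (u : 'M[C]_n.+1), [/\ ucorep u, irr u & D = mxspan u].
Proof.
move=> [hD D0 Dmin].
have [x Dx x0] : exists2 x, D x & x != 0.
  apply: contrapT => h; apply: D0; apply/seteqP; split=> x; last first.
    by move=> /= ->; case: hD => -[].
  by move=> Dx; apply: contrapT => /eqP x0; apply: h; exists x.
have [n [u [hu iu [k [l fx]]]]] : exists n (u : 'M[C]_n.+1),
    [/\ ucorep u, irr u & exists k l, f x (u k l) != 0].
  apply: contrapT => h; case/eqP: x0; apply: (inner_product_eq0 hf).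
  move: {2}x; apply: irr_ind => [|n u hu iu k l].
    split=> [|a y1 y2 h1 h2]; first exact: sesqui0r.
    by rewrite sesquiDr // sesquiZr // h1 h2 mulr0 addr0.
  apply: contrapT => /eqP hx; apply: h; exists n, u; split=> //.
  by exists k, l.
(* By orthogonality, convolution with an entry of [u] kills every irreducible whose span differs
   from that of [u]. *)
have hy : mxspan u (convr (fl (u k l)) x).
  move: x {Dx x0 fx}; apply: irr_ind => [|m v hv iv i j].
    split=> [|a y1 y2 h1 h2]; first by rewrite linear0; case: (mxspan_subspace u).
    by rewrite linearP; case: (mxspan_subspace u) => _; apply.
  rewrite (convr_corep _ _ _ hv.1).
  have [uv|uv] := pselect (mxspan v = mxspan u).
    rewrite -uv; apply: subspace_sum => [|p _]; first exact: mxspan_subspace.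
    by apply: subspaceZ; [exact: mxspan_subspace|exact: mxspan_entry].
  rewrite big1 => [|p _]; first by case: (mxspan_subspace u).
  rewrite inner_scalarE (intertwining_orth hv hu iv iu) ?scale0r //.
  exact: unitary_intertwining.
exists n, u; split=> //.
have uD y : mxspan u y -> D y.
  apply: mxspan_min => [|i j]; first by case: hD.
  apply: (irr_sub_subcoalgebra hu iu hD _ hy); first exact: subcoalgebra_convr.
  apply: contra_neq fx => h; rewrite -[LHS]/(fl (u k l) x) -counit_convr h.
  exact: linear0.
have [h0|->//] := Dmin _ (mxspan_subcoalgebra hu.1) uD.
by have [_ /(_ h0)] := irr_simple hu iu.
Qed.

End Orthogonality.

(** * Coproduct of the antipode *)

(** A separate name, so that [tmul] is the ring structure only where matrices over A ⊗ A are
    multiplied and inverted. *)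
Definition talg (K : comNzRingType) (A : algType K) : Type := tensor A A.

Section TensorAlgebra.
Variables (K : comNzRingType) (A : algType K).

HB.instance Definition _ := GRing.Zmodule.on (talg A).

Fact balanced_tmul_inner (a b : A) :
  balanced (fun c d : A => (a * c) ⊗ (b * d)).
Proof.
split=> *; rewrite ?mulrDr ?tensDl ?tensDr //.
by rewrite -!scalerAr tensZl tensZr.
Qed.

Fact balanced_tmul (t : tensor A A) :
  balanced (fun a b : A => tsum (fun c d => (a * c) ⊗ (b * d)) t).
Proof.
split=> *; rewrite /tsum /fsum -?big_split; apply: eq_bigr => p _.
- by rewrite mulrDl tensDl.
- by rewrite mulrDl tensDr.
- by rewrite -!scalerAl tensZl tensZr.
Qed.

Fact tmulDl : left_distributive (@tmul K A) +%R.
Proof. by move=> s t r; rewrite /tmul tsumD //; exact: balanced_tmul. Qed.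

Fact tmulDr : right_distributive (@tmul K A) +%R.
Proof.
move=> s t r; rewrite /tmul /tsum /fsum -big_split; apply: eq_bigr => p _.
exact: (tsumD t r (balanced_tmul_inner p.1 p.2)).
Qed.

Lemma tmul_tens (a b c d : A) : tmul (a ⊗ b) (c ⊗ d) = (a * c) ⊗ (b * d).
Proof.
rewrite /tmul tsum_tens; last exact: balanced_tmul.
by rewrite tsum_tens //; exact: balanced_tmul_inner.
Qed.

Lemma tmul_suml I (r : seq I) (F : I -> tensor A A) t :
  tmul (\sum_(i <- r) F i) t = \sum_(i <- r) tmul (F i) t.
Proof.
apply: (big_morph (fun s => tmul s t)) => [x y|]; first exact: tmulDl.
by apply: (@addrI _ (tmul 0 t)); rewrite -tmulDl !addr0.
Qed.

Lemma tmul_sumr I (r : seq I) (F : I -> tensor A A) t :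
  tmul t (\sum_(i <- r) F i) = \sum_(i <- r) tmul t (F i).
Proof.
apply: big_morph => [x y|]; first exact: tmulDr.
by apply: (@addrI _ (tmul t 0)); rewrite -tmulDr !addr0.
Qed.

Fact tmulA : associative (@tmul K A).
Proof.
move=> x y z; have [r ->] := tensor_span x; have [s ->] := tensor_span y.
have [t ->] := tensor_span z.
rewrite !tmul_suml; apply: eq_bigr => p _.
rewrite !(tmul_sumr _ _ (p.1 ⊗ p.2)) tmul_suml.
apply: eq_bigr => q _.
rewrite !tmul_sumr; apply: eq_bigr => v _.
by rewrite !tmul_tens !mulrA.
Qed.

Fact tmul1l : left_id ((1 : A) ⊗ (1 : A)) (@tmul K A).
Proof.
move=> x; have [r ->] := tensor_span x; rewrite tmul_sumr.
by apply: eq_bigr => p _; rewrite tmul_tens !mul1r.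
Qed.

Fact tmul1r : right_id ((1 : A) ⊗ (1 : A)) (@tmul K A).
Proof.
move=> x; have [r ->] := tensor_span x; rewrite tmul_suml.
by apply: eq_bigr => p _; rewrite tmul_tens !mulr1.
Qed.

HB.instance Definition _ := GRing.Zmodule_isPzRing.Build (talg A)
  tmulA tmul1l tmul1r tmulDl tmulDr.

Definition tens1r (a : A) : talg A := a ⊗ 1.
Definition tens1l (a : A) : talg A := 1 ⊗ a.

Lemma talg_mul_tens (a b c d : A) :
  (a ⊗ b : talg A) * (c ⊗ d : talg A) = (a * c) ⊗ (b * d).
Proof. exact: tmul_tens. Qed.

Lemma map_tens1r_mul m n p (X : 'M[A]_(m, n)) (Y : 'M_(n, p)) :
  map_mx tens1r (X *m Y) = map_mx tens1r X *m map_mx tens1r Y.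
Proof.
apply/matrixP => i k; rewrite !mxE /tens1r tens_suml; apply: eq_bigr => j _.
by rewrite !mxE talg_mul_tens mulr1.
Qed.

Lemma map_tens1l_mul m n p (X : 'M[A]_(m, n)) (Y : 'M_(n, p)) :
  map_mx tens1l (X *m Y) = map_mx tens1l X *m map_mx tens1l Y.
Proof.
apply/matrixP => i k; rewrite !mxE /tens1l tens_sumr; apply: eq_bigr => j _.
by rewrite !mxE talg_mul_tens mulr1.
Qed.

Lemma map_tens1r1 n : map_mx tens1r 1%:M = 1%:M :> 'M_n.
Proof.
apply/matrixP => i j; rewrite !mxE /tens1r; case: eqP => // _.
exact: tens0l.
Qed.

Lemma map_tens1l1 n : map_mx tens1l 1%:M = 1%:M :> 'M_n.
Proof.
apply/matrixP => i j; rewrite !mxE /tens1l; case: eqP => // _.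
exact: tens0r.
Qed.

End TensorAlgebra.

Section HopfCoreps.
Variables (K : fieldType) (H : hopfType K).

Lemma antipode_mulmx n (v : 'M[H]_n) : corep v ->
  map_mx antipode v *m v = 1%:M.
Proof.
move=> hv; apply/matrixP => i j; rewrite !mxE.
have := antipodel (v i j); rewrite (corep_comul _ _ hv) tsum_sum_tens.
  rewrite (corep_counit _ _ hv) scaler_nat => <-.
  by apply: eq_bigr => k _; rewrite mxE.
split=> *; rewrite ?linearD ?mulrDl ?mulrDr //.
by rewrite linearZ /= -scalerAl -scalerAr.
Qed.

Lemma mulmx_antipode n (v : 'M[H]_n) : corep v ->
  v *m map_mx antipode v = 1%:M.
Proof.
move=> hv; apply/matrixP => i j; rewrite !mxE.
have := antipoder (v i j); rewrite (corep_comul _ _ hv) tsum_sum_tens.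
  rewrite (corep_counit _ _ hv) scaler_nat => <-.
  by apply: eq_bigr => k _; rewrite mxE.
split=> *; rewrite ?linearD ?mulrDl ?mulrDr //.
by rewrite linearZ /= -scalerAl -scalerAr.
Qed.

(* Both sides are the inverse of comul v in the matrices over H ⊗ H. *)
Lemma comul_antipode n (v : 'M[H]_n) l k : corep v ->
  comul (antipode (v l k)) =
    \sum_p antipode (v p k) ⊗ antipode (v l p).
Proof.
move=> hv; pose s := map_mx antipode v.
pose A : 'M[talg H]_n := map_mx comul s.
pose V : 'M[talg H]_n := map_mx comul v.
pose B : 'M[talg H]_n := map_mx (@tens1l _ H) s *m map_mx (@tens1r _ H) s.
have VE : V = map_mx (@tens1r _ H) v *m map_mx (@tens1l _ H) v.
  apply/matrixP => i j; rewrite !mxE (corep_comul _ _ hv).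
  by apply: eq_bigr => m _; rewrite !mxE talg_mul_tens mulr1 mul1r.
have VB : V *m B = 1%:M.
  rewrite VE /B mulmxA -(mulmxA (map_mx _ v)) -map_tens1l_mul mulmx_antipode //.
  by rewrite map_tens1l1 mulmx1 -map_tens1r_mul mulmx_antipode // map_tens1r1.
have AV : A *m V = 1%:M.
  have := congr1 (map_mx (comul : H -> talg H)) (antipode_mulmx hv).
  move=> /matrixP h; apply/matrixP => i j; have := h i j; rewrite !mxE.
  rewrite linear_sum /= => e; transitivity (comul ((i == j)%:R : H)).
    by rewrite -e; apply: eq_bigr => m _; rewrite !mxE comulM.
  by case: eqP => _; rewrite ?comul1 ?linear0.
have : A = B by rewrite -[A]mulmx1 -VB mulmxA AV mul1mx.
move=> /matrixP/(_ l k); rewrite !mxE => ->; apply: eq_bigr => p _.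
by rewrite !mxE talg_mul_tens mulr1 mul1r.
Qed.

End HopfCoreps.

(** * The normal integral *)

(** Polarization with x + y and x + i y. It makes the form twisted by S_+ hermitian from the sign of
    its diagonal values. *)
Lemma sesquilinear_hermitian (K : numClosedFieldType) (V : lmodType K)
    (F : V -> V -> K) : sesquilinear F -> (forall x, 0 <= F x x) ->
  forall x y, F x y = (F y x)^*.
Proof.
move=> sF F0 x y.
have re z : (F z z)^* = F z z by rewrite geC0_conj.
have h1 : (F x y)^* + (F y x)^* = F x y + F y x.
  have := re (x + y).
  rewrite sesquiDl // !sesquiDr // !rmorphD /= !re => h.
  transitivity (F x x + (F x y)^* + ((F y x)^* + F y y) - F x x - F y y).
    by ring.
  by rewrite h; ring.
have h2 : (F y x)^* - (F x y)^* = F x y - F y x.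
  have := re (x + 'i *: y).
  rewrite sesquiDl // !sesquiDr // !(sesquiZl, sesquiZr) //.
  rewrite !(rmorphD, rmorphM) /= !re conjCK conjCi => h.
  have i2 : 'i * 'i = -1 :> K by rewrite -expr2 sqrCi.
  transitivity (- ('i * 'i) * ((F y x)^* - (F x y)^*)).
    by rewrite i2 opprK mul1r.
  transitivity ('i * (F x x + 'i * (F x y)^* + (- 'i * (F y x)^* +
      - 'i * ('i * F y y)) - F x x + 'i * 'i * F y y)).
    by ring.
  by rewrite h; have -> : F x y - F y x = - ('i * 'i) * (F x y - F y x);
    [rewrite i2 opprK mul1r|ring].
have h3 : (2 : K) != 0 by rewrite pnatr_eq0.
apply: (mulfI h3); rewrite !mulr_natl !mulr2n.
transitivity (F x y + F y x + (F x y - F y x)); first by ring.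
by rewrite -h1 -h2; ring.
Qed.

Lemma irr_conj (K : numClosedFieldType) (C : circCoalgType K) n (u : 'M[C]_n)
    (Q : 'M[K]_n) : Q \is unitarymx -> irr u -> irr (lact Q (ract u (Q ^t* ))).
Proof.
move=> hQ iu X; have QV := unitarymxV hQ; have /unitarymxP QQ := hQ.
set u' := lact Q _ => hX.
have uE : u = lact (Q ^t* ) (ract u' Q).
  by rewrite /u' -lact_ract ractA QV ract1 lactA QV lact1.
clearbody u'; have [|c hc] := iu (Q ^t* *m X *m Q).
  rewrite {1}uE lactA -(mulmxA _ Q) QQ mulmx1 -lactA (lact_ract X) hX ractA.
  by rewrite [in RHS]uE -lact_ract ractA !mulmxA QQ mul1mx.
exists c; have : Q *m (Q ^t* *m X *m Q) *m Q ^t* = X.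
  by rewrite !mulmxA QQ mul1mx -mulmxA QQ mulmx1.
by move=> <-; rewrite hc mul_mx_scalar -scalemxAl QQ scalemx1.
Qed.

Lemma mxspan_conj (K : numClosedFieldType) (C : circCoalgType K) n
    (u : 'M[C]_n) (Q : 'M[K]_n) :
  Q \is unitarymx -> mxspan (lact Q (ract u (Q ^t* ))) = mxspan u.
Proof.
move=> hQ; have QV := unitarymxV hQ; set u' := lact _ _.
have uE : u = lact (Q ^t* ) (ract u' Q).
  by rewrite /u' -lact_ract ractA QV ract1 lactA QV lact1.
apply/seteqP; split=> x; apply: mxspan_min => [|i j];
  try exact: mxspan_subspace.
  apply: subspace_lact => [|p q]; first exact: mxspan_subspace.
  by apply: subspace_ract => [|r s]; [exact: mxspan_subspace|exact: mxspan_entry].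
rewrite uE; apply: subspace_lact => [|p q]; first exact: mxspan_subspace.
by apply: subspace_ract => [|r s]; [exact: mxspan_subspace|exact: mxspan_entry].
Qed.

Section Integral.
Variables (K : numClosedFieldType) (H : circHopfType K) (f : H -> H -> K).
Hypotheses (hf : inner_product f) (uf : unitary (@comul K H) f).
Variable phi : {scalar H}.
Hypothesis hphi : normal_integral phi.

(** On an irreducible [u] either the component is that of 1, where u_kl is 1 or 0 according to k =
    l, or [phi] vanishes on all entries and both sides are 0. *)
Lemma integral_invariant z : convl phi z = (phi z)%:A.
Proof.
move: z; apply: (irr_ind hf uf) => [|n u hu iu i j].
  split=> [|a x y hx hy]; first by rewrite !linear0 scale0r.
  by rewrite !linearP /= hx hy scalerDl scalerA.
rewrite (convl_corep _ _ _ hu.1).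
have [h1|h1] := pselect (mxspan u = range (fun a : K => a%:A : H)).
  have uE k l : u k l = ((k == l)%:R : K)%:A.
    have : mxspan u (u k l) by exact: mxspan_entry.
    rewrite h1 => -[c _ e]; rewrite -e; congr (_ *: _).
    have := corep_counit k l hu.1; rewrite -e linearZ /= counit1 mulr1 => ->.
    by [].
  rewrite (bigD1 i) //= big1 ?addr0 => [|k /negPf ki].
    rewrite !uE !linearZ /= hphi.1 eqxx !mulr1 scale1r.
    by [].
  by rewrite uE linearZ /= eq_sym ki mul0r scale0r.
have phi0 k l : phi (u k l) = 0.
  by apply: (hphi.2 _ (irr_simple hf uf hu iu) h1); exact: mxspan_entry.
by rewrite phi0 scale0r big1 // => k _; rewrite phi0 scale0r.
Qed.

Lemma hform_sesquilinear : sesquilinear (hform phi).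
Proof.
rewrite /hform; split=> [v a x y|u a v w].
  by rewrite mulrDr -scalerAr linearP.
by rewrite circD circZ linearP mulrDl -scalerAl linearP.
Qed.

(** Invariance of [phi] at S(v_lk) u_ij says that S(v) T u = T, and v is the inverse of S(v). The
    first matrix is just a corepresentation, because the lemma is later applied to S_+(u). *)
Lemma hform_intertwining n m (u : 'M[H]_n) (v : 'M[H]_m) :
  corep u -> ucorep v -> intertwining (hform phi) u v.
Proof.
move=> hu hv i k /=; set T := \matrix_(_, _) _.
have TE l j : T l j = phi (antipode (v l k) * u i j).
  by rewrite mxE /hform (ucorep_circ _ _ hv).
have sT : map_mx antipode v *m lact T u = map_mx (fun a => a%:A) T.
  apply/matrixP => l j; rewrite [RHS]mxE TE -integral_invariant mxE.
  (* The coproduct of S(v_lk) u_ij is written as one sum over pairs (p, q). *)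
  rewrite (@convlE _ _ _ _ _ (index_enum ('I_m * 'I_n)%type)
    (fun p => antipode (v p.1 k) * u i p.2)
    (fun p => antipode (v l p.1) * u p.2 j)).
    rewrite -(pair_bigA _ (fun p q => phi (antipode (v p k) * u i q) *:
      (antipode (v l p) * u q j))) /=.
    apply: eq_bigr => p _; rewrite mxE mxE mulr_sumr; apply: eq_bigr => q _.
    by rewrite TE scalerAr.
  rewrite comulM (comul_antipode _ _ hv.1) (corep_comul _ _ hu) tmul_suml.
  rewrite -(pair_bigA _ (fun p q => (antipode (v p k) * u i q) ⊗
      (antipode (v l p) * u q j))) /=.
  apply: eq_bigr => p _; rewrite tmul_sumr; apply: eq_bigr => q _.
  exact: tmul_tens.
rewrite -[LHS]mul1mx -(mulmx_antipode hv.1) -mulmxA sT.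
apply/matrixP => l j; rewrite !mxE; apply: eq_bigr => p _.
by rewrite [in LHS]mxE -scalerAr mulr1.
Qed.

Lemma simple_orth (F : H -> H -> K) (D E : set H) x y : sesquilinear F ->
  (forall n m (u : 'M[H]_n) (v : 'M[H]_m), ucorep u -> ucorep v ->
    intertwining F u v) ->
  simple_subcoalgebra D -> simple_subcoalgebra E -> D <> E ->
  D x -> E y -> F x y = 0.
Proof.
move=> sF hF /(simple_irr hf uf)[n [u [hu iu ->]]].
move=> /(simple_irr hf uf)[m [v [hv iv ->]]] uv.
move=> hx hy; have hD : forall i j, F (u i j) y = 0.
  move=> i j; pose D2 : set H := fun y => F (u i j) y = 0.
  apply: (@mxspan_min _ _ _ v D2) hy => [|k l]; rewrite /D2.
    split=> [|a x1 x2 h1 h2]; first exact: sesqui0r.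
    by rewrite sF.2 h1 // h2 // mulr0 addr0.
  exact: (intertwining_orth hu hv iu iv (hF _ _ _ _ hu hv) uv).
pose D1 : set H := fun x => F x y = 0.
apply: (@mxspan_min _ _ _ u D1) hx => //; rewrite /D1.
split=> [|a x1 x2 h1 h2]; first exact: sesqui0l.
by rewrite sF.1 h1 // h2 // mulr0 addr0.
Qed.

End Integral.

(** * Diagonalization of the positive antipode *)

Section PositiveAntipode.
Variables (K : numClosedFieldType) (H : circHopfType K) (f : H -> H -> K).
Hypotheses (hf : inner_product f) (uf : unitary (@comul K H) f).
Let sf := inner_product_sesquilinear hf.
Variable phi : {scalar H}.
Hypothesis hphi : normal_integral phi.
Variable Sp : {lrmorphism H -> H}.
Hypothesis hSp : positive_antipode phi Sp.
Let sh := hform_sesquilinear phi.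

Lemma map_antipode_corep n (u : 'M[H]_n) : corep u -> corep (map_mx Sp u).
Proof.
have [_ [h1 h2] _ _] := hSp => hu; split; apply/matrixP => i j; rewrite !mxE.
  rewrite h1 (corep_comul _ _ hu) /tmap tsum_sum_tens.
    by apply: eq_bigr => k _; rewrite !mxE.
  exact: (balanced_map Sp Sp).
by rewrite h2 (corep_counit _ _ hu).
Qed.

Lemma gram_sesquilinear : sesquilinear (fun x y => hform phi (Sp x) y).
Proof. by split=> [v a x y|v a x y]; rewrite ?linearP /= ?sh.1 ?sh.2. Qed.

Lemma gram_gt0 x : x != 0 -> 0 < hform phi (Sp x) x.
Proof. by have [_ _ [_ h] _] := hSp; exact: h. Qed.

Lemma gram_ge0 x : 0 <= hform phi (Sp x) x.
Proof.
have [->|/gram_gt0/ltW//] := eqVneq x 0.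
by rewrite (sesqui0r sh).
Qed.

(* For a fixed row i the Gram matrix of the form (x, y) |-> <Sp x, y> on the
   u i j is positive definite and intertwines Sp(u) with u; v is u in an
   orthonormal basis of eigenvectors of that matrix. *)
Lemma irr_diagonalize n (u : 'M[H]_n.+1) : ucorep u -> irr u ->
  exists (v : 'M[H]_n.+1) (b : 'I_n.+1 -> K),
    [/\ ucorep v, irr v, mxspan v = mxspan u, forall i, 0 < b i
      & forall i j, Sp (v i j) = (b i / b j) *: v i j].
Proof.
move=> hu iu; pose q x y := hform phi (Sp x) y.
have sq : sesquilinear q by exact: gram_sesquilinear.
pose T : 'M[K]_n.+1 := \matrix_(l, j) q (u ord0 j) (u ord0 l).
have hT : lact T (map_mx Sp u) = ract u T.
  have -> : T = \matrix_(l, j) hform phi (map_mx Sp u ord0 j) (u ord0 l).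
    by apply/matrixP => l j; rewrite !mxE.
  exact: (hform_intertwining hf uf hphi (map_antipode_corep hu.1) hu).
have Th : T ^t* = T.
  apply/matrixP => l j; rewrite !mxE -(sesquilinear_hermitian sq) //.
  exact: gram_ge0.
have /orthomx_spectralP : T \is normalmx by apply/normalmxP; rewrite Th.
set Q := spectralmx T; set d := spectral_diag T => Tdiag.
have hQ : Q \is unitarymx by exact: spectral_unitarymx.
have QV := unitarymxV hQ; have /unitarymxP QQ := hQ.
rewrite invmx_unitary // in Tdiag.
pose v := lact Q (ract u (Q ^t* )).
have dE : diag_mx d = Q *m T *m Q ^t*.
  by rewrite Tdiag !mulmxA QQ mul1mx -mulmxA QQ mulmx1.
have d_gt0 i : 0 < d 0 i.
  (* The eigenvector belonging to row [i] of [Q], placed in row 0 of [u]: the twisted form takes the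
     eigenvalue as its value there. *)
  pose y := \sum_j (Q i j)^* *: u ord0 j.
  have -> : d 0 i = q y y.
    have /matrixP/(_ i i) := dE; rewrite !mxE eqxx mulr1n => ->.
    rewrite /y (sesqui_suml sq); apply: eq_bigr => j _.
    rewrite (sesquiZl sq) (sesqui_sumr sq) mulrC !mxE; congr (_ * _).
    by apply: eq_bigr => l _; rewrite (sesquiZr sq) conjCK mxE.
  apply: gram_gt0; apply/eqP => y0.
  (* The entries of row 0 are independent, so [y = 0] would make a row of the unitary [Q] vanish. *)
  have [z [_ hz]] := irr_dual hf uf hu iu.
  have Q0 j : Q i j = 0.
    have : f y (z ord0 j) = 0 by rewrite y0 (sesqui0l sf).
    rewrite /y (sesqui_suml sf) (bigD1 j) //= big1 => [|k /negPf kj].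
      by rewrite (sesquiZl sf) hz !eqxx mulr1 addr0 => /eqP; rewrite conjC_eq0 => /eqP.
    by rewrite (sesquiZl sf) hz kj andbF mulr0.
  have /matrixP/(_ i i) := QQ; rewrite !mxE eqxx big1 => [|j _].
    by move/esym/eqP; rewrite oner_eq0.
  by rewrite Q0 mul0r.
(* In the eigenbasis the relation T S_+(u) = u T reads d_i S_+(v_ij) = d_j v_ij, so b_i is the
   inverse of the eigenvalue d_i. *)
exists v, (fun i => (d 0 i)^-1); split.
- exact: ucorep_conj.
- exact: irr_conj.
- exact: mxspan_conj.
- by move=> i; rewrite invr_gt0.
have hd : lact (diag_mx d) (map_mx Sp v) = ract v (diag_mx d).
  rewrite dE /v map_lact map_ract lactA -!mulmxA QV mulmx1 -lact_ract ractA.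
  by rewrite !mulmxA QV mul1mx -lactA (lact_ract T) hT ractA.
clearbody v; move=> i j; have /matrixP/(_ i j) := hd; rewrite !mxE.
rewrite (bigD1 i) //= big1 => [|l /negPf li]; last first.
  by rewrite mxE eq_sym li mulr0n scale0r.
rewrite (bigD1 j) //= big1 => [|l /negPf li]; last first.
  by rewrite mxE li mulr0n scale0r.
rewrite !addr0 ![diag_mx d _ _]mxE !eqxx !mulr1n [map_mx _ _ _ _]mxE => e.
rewrite invrK -scalerA -e scalerA mulVf ?scale1r //.
by rewrite gt_eqF.
Qed.

(** This finiteness stands in for the direct sum decomposition of [H]: it makes the sums over
    components in [glue] finite. *)
Lemma simple_support x : exists U : seq (set H), forall D,
  simple_subcoalgebra D -> D \notin U -> forall w, D w -> f x w = 0.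
Proof.
move: x; apply: (irr_ind hf uf) => [|n u hu iu i j].
  split=> [|a x y [U hU] [V hV]].
    by exists [::] => D _ _ w _; rewrite (sesqui0l sf).
  exists (U ++ V) => D hD; rewrite mem_cat negb_or => /andP[DU DV] w Dw.
  by rewrite sf.1 (hU D) // (hV D) // mulr0 addr0.
exists [:: mxspan u] => D hD; rewrite inE => /eqP Du w Dw.
apply: (simple_orth hf uf sf _ (irr_simple hf uf hu iu) hD _ _ Dw).
- by move=> n' m u' v' hu' hv'; exact: unitary_intertwining.
- by move=> e; apply: Du.
- exact: mxspan_entry.
Qed.

(** The value at [x] sums the pairings over a finite support of [x]. By [SU] a longer list gives the
    same value, so one common list serves for two vectors and their combination, which yields
    linearity. *)
Lemma glue (y : set H -> H) : (forall D, simple_subcoalgebra D -> D (y D)) ->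
  exists s : {scalar H}, forall D, simple_subcoalgebra D ->
    forall x, D x -> s x = f x (y D).
Proof.
move=> hy; have [U hU] := choice simple_support.
pose S (V : seq (set H)) x :=
  \sum_(D <- undup V | `[< simple_subcoalgebra D >]) f x (y D).
have SU V x : {subset U x <= V} -> S V x = S (U x) x.
  move=> hV; rewrite /S (bigID (mem (U x))) /= [X in _ + X]big1 ?addr0; last first.
    by move=> D /andP[/asboolP hD DU]; apply: (hU x D) => //; exact: hy.
  rewrite (eq_bigl _ _ (fun D => andbC _ _)) -big_filter_cond.
  apply: perm_big; apply: uniq_perm; rewrite ?filter_uniq ?undup_uniq // => D.
  by rewrite mem_filter !mem_undup; case: (boolP (D \in U x)) => // /hV ->.
have lin : scalar (fun x => S (U x) x).
  move=> a x x'; pose V := U (a *: x + x') ++ U x ++ U x'.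
  have h1 : {subset U (a *: x + x') <= V} by move=> D; rewrite mem_cat => ->.
  have h2 : {subset U x <= V} by move=> D; rewrite !mem_cat => ->; rewrite orbT.
  have h3 : {subset U x' <= V} by move=> D; rewrite !mem_cat => ->; rewrite !orbT.
  rewrite -(SU _ _ h1) -(SU _ _ h2) -(SU _ _ h3) /S mulr_sumr -big_split.
  apply: eq_bigr => D _; exact: sf.1.
exists (scalar_of lin) => D hD x Dx; rewrite -[LHS]/(S (U x) x).
rewrite -(SU (D :: U x)) => [|E EU]; last by rewrite inE EU orbT.
rewrite /S big_mkcond (bigD1_seq D) ?undup_uniq ?mem_undup ?mem_head //=.
rewrite asboolT // big1 ?addr0 // => E /eqP ED; case: asboolP => // hE.
apply: (simple_orth hf uf sf _ hD hE _ Dx (hy _ hE)) => [n m u v hu hv|e].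
  exact: unitary_intertwining.
by apply: ED.
Qed.

End PositiveAntipode.

(** * Convolution of functionals *)

Section Convolution.
Variables (K : fieldType) (C : coalgType K).

Fact balanced_conv (s t : {scalar C}) : balanced (fun x y : C => s x * t y).
Proof.
split=> *; rewrite ?linearD ?mulrDl ?mulrDr //.
by rewrite !linearZ /= mulrCA mulrA.
Qed.

Fact conv_scalar (s t : {scalar C}) : scalar (conv s t).
Proof.
move=> a x y; rewrite /conv linearP tsumD; last exact: balanced_conv.
congr (_ + _); apply: (@tsumZ K C C K^o); first exact: balanced_conv.
by move=> v w; rewrite linearZ /= -mulrA.
Qed.

HB.instance Definition _ (s t : {scalar C}) :=
  GRing.isLinear.Build K C K *%R (conv s t) (conv_scalar s t).

Lemma conv_corep (s t : {scalar C}) n (u : 'M[C]_n) i j : corep u ->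
  conv s t (u i j) = \sum_k s (u i k) * t (u k j).
Proof.
by move=> hu; rewrite /conv (corep_comul _ _ hu) tsum_sum_tens //;
  exact: balanced_conv.
Qed.

End Convolution.

(** * Functional calculus in an eigenbasis of the positive antipode *)

Section EigenBasis.
Variables (K : numClosedFieldType) (H : circHopfType K) (f : H -> H -> K).
Hypotheses (hf : inner_product f) (uf : unitary (@comul K H) f).
Let sf := inner_product_sesquilinear hf.
Variable phi : {scalar H}.
Hypothesis hphi : normal_integral phi.
Variable Sp : {lrmorphism H -> H}.
Hypothesis hSp : positive_antipode phi Sp.
Let sh := hform_sesquilinear phi.

(** The families are indexed by all sets [D], so that they come from a single application of choice;
    their values off the simple components are arbitrary. *)
Definition eigen_basis (n : set H -> nat) (u : forall D, 'M[H]_((n D).+1))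
    (b : forall D, 'I_(n D).+1 -> K) : Prop :=
  forall D, simple_subcoalgebra D ->
    [/\ ucorep (u D), irr (u D), D = mxspan (u D), forall i, 0 < b D i
      & forall i j, Sp (u D i j) = (b D i / b D j) *: u D i j].

Lemma eigen_basis_exists : exists n u b, @eigen_basis n u b.
Proof.
pose X := {n & ('M[H]_n.+1 * ('I_n.+1 -> K))%type}.
pose good (D : set H) (x : X) := simple_subcoalgebra D ->
  [/\ ucorep (projT2 x).1, irr (projT2 x).1, D = mxspan (projT2 x).1,
      forall i, 0 < (projT2 x).2 i
    & forall i j, Sp ((projT2 x).1 i j) =
        ((projT2 x).2 i / (projT2 x).2 j) *: (projT2 x).1 i j].
have [D|x hx] := @choice _ _ good; last first.
  by exists (fun D => projT1 (x D)), (fun D => (projT2 (x D)).1),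
    (fun D => (projT2 (x D)).2).
have [hD|hD] := pselect (simple_subcoalgebra D); last first.
  by exists (existT _ 0 (0, fun=> 0)).
have [n [u [hu iu DE]]] := simple_irr hf uf hD.
have [v [b [hv iv uv b0 hb]]] := irr_diagonalize hf uf hphi hSp hu iu.
by exists (existT _ n (v, b)) => _; split=> //=; rewrite DE uv.
Qed.

Variables (n : set H -> nat) (u : forall D, 'M[H]_((n D).+1)).
Variable b : forall D, 'I_(n D).+1 -> K.
Hypothesis hb : eigen_basis u b.

Lemma eigen_basis_mem D i j : simple_subcoalgebra D -> D (u D i j).
Proof.
move=> hD; have := mxspan_entry (u D) i j.
by have [_ _ <- _ _] := hb hD.
Qed.

Lemma eigen_basis_ind (P : set H) : subspace P ->
  (forall D, simple_subcoalgebra D -> forall i j, P (u D i j)) ->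
  forall x, P x.
Proof.
move=> hP h; apply: (irr_ind hf uf hP) => m v hv iv i j.
have hD := irr_simple hf uf hv iv; have [_ _ DE _ _] := hb hD.
have : mxspan (u (mxspan v)) (v i j) by rewrite -DE; exact: mxspan_entry.
by apply: mxspan_min => // k l; exact: h.
Qed.

Lemma eq_on_basis (L M : {linear H -> H}) :
  (forall D, simple_subcoalgebra D -> forall i j,
    L (u D i j) = M (u D i j)) -> L =1 M.
Proof.
move=> h x; move: x; apply: eigen_basis_ind => //.
split=> [|a x y hx hy]; first by rewrite !linear0.
by rewrite !linearP hx hy.
Qed.

Lemma eq_scalar_on_basis (s t : {scalar H}) :
  (forall D, simple_subcoalgebra D -> forall i j,
    s (u D i j) = t (u D i j)) -> s =1 t.
Proof.
move=> h x; move: x; apply: eigen_basis_ind => //.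
split=> [|a x y hx hy]; first by rewrite !linear0.
by rewrite !linearP hx hy.
Qed.

(** Functional calculus: [s] is w(beta) for the diagonal functional with eigenvalues b_i. Suitable
    [w] give beta, its inverse and their square roots. *)
Definition diag_scalar (w : K -> K) (s : {scalar H}) : Prop :=
  forall D, simple_subcoalgebra D ->
    forall i j, s (u D i j) = w (b i) *+ (i == j).

Lemma diag_scalar_exists w : exists s, diag_scalar w s.
Proof.
have [D|y hy] := @choice _ _ (fun (D : set H) y => simple_subcoalgebra D ->
    D y /\ forall i j, f (u D i j) y = w (b i) *+ (i == j)).
  have [hD|] := pselect (simple_subcoalgebra D); last by exists 0.
  have [hu iu DE _ _] := hb hD; have [z [uz hz]] := irr_dual hf uf hu iu.
  (* The conjugate compensates for [f] being conjugate linear in its second variable. *)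
  exists (\sum_k (w (b k))^* *: z k k) => _; split=> [|i j].
    have sub x : mxspan (u D) x -> D x by rewrite -DE.
    apply: sub; apply: subspace_sum => [|k _]; first exact: mxspan_subspace.
    by apply: subspaceZ; [exact: mxspan_subspace|exact: uz].
  rewrite (sesqui_sumr sf) (bigD1 i) //= big1 => [|k /negPf ki].
    rewrite (sesquiZr sf) conjCK hz eqxx eq_sym addr0 mulr_natr.
    by [].
  by rewrite (sesquiZr sf) hz eq_sym ki mulr0.
have [s hs] := glue hf uf (fun D hD => (hy D hD).1).
exists s => D hD i j; rewrite (hs D) //; first exact: (hy D hD).2.
exact: eigen_basis_mem.
Qed.

Section DiagScalar.
Variables (w : K -> K) (s : {scalar H}).
Hypothesis hs : diag_scalar w s.

Lemma convl_diag D i j : simple_subcoalgebra D ->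
  convl s (u D i j) = w (b i) *: u D i j.
Proof.
move=> hD; have [hu _ _ _ _] := hb hD.
rewrite (convl_corep _ _ _ hu.1) (bigD1 i) //= big1 => [|k /negPf ki].
  by rewrite hs // eqxx addr0.
by rewrite hs // eq_sym ki scale0r.
Qed.

Lemma convr_diag D i j : simple_subcoalgebra D ->
  convr s (u D i j) = w (b j) *: u D i j.
Proof.
move=> hD; have [hu _ _ _ _] := hb hD.
rewrite (convr_corep _ _ _ hu.1) (bigD1 j) //= big1 => [|k /negPf kj].
  by rewrite hs // eqxx addr0.
by rewrite hs // kj scale0r.
Qed.

Lemma conv_diag w' s' : diag_scalar w' s' ->
  diag_scalar (fun a => w a * w' a) (conv s s').
Proof.
move=> hs' D hD i j; have [hu _ _ _ _] := hb hD.
rewrite /= (conv_corep _ _ _ _ hu.1) (bigD1 i) //= big1 => [|k /negPf ki].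
  by rewrite hs // hs' // eqxx addr0 mulrnAr.
by rewrite hs // eq_sym ki mul0r.
Qed.

End DiagScalar.

(** Schur orthogonality forces j = l, and selfadjointness of S_+ then equates b_i / b_j with b_k /
    b_j. Distinct rows may still pair nontrivially, but only when their eigenvalues agree. *)
Lemma hform_eigen D i j k l : simple_subcoalgebra D ->
  hform phi (u D i j) (u D k l) != 0 -> b i = b k /\ b j = b l.
Proof.
move=> hD h0; have [hu iu _ b0 Su] := hb hD.
have [c hc] := intertwining_diag iu (hform_intertwining hf uf hphi hu.1 hu) i k.
have jl : j = l.
  by apply/eqP; move: h0; rewrite hc; case: (j == l); rewrite ?mulr0n ?eqxx.
split; last by rewrite jl.
have [_ _ [sa _] _] := hSp; have := sa (u D i j) (u D k l).
rewrite !Su (sesquiZl sh) (sesquiZr sh) geC0_conj ?divr_ge0 1?ltW //.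
by move/(mulIf h0); rewrite jl => /mulIf; apply; rewrite invr_eq0 gt_eqF.
Qed.

(** Distinct components are orthogonal, and within one component entries with nonzero pairing have
    equal eigenvalues by [hform_eigen], hence are scaled by the same real factor. *)
Lemma diag_selfadjoint (g : K -> K -> K) (L : {linear H -> H}) :
  (forall a c, 0 < a -> 0 < c -> (g a c)^* = g a c) ->
  (forall D, simple_subcoalgebra D -> forall i j,
     L (u D i j) = g (b i) (b j) *: u D i j) ->
  selfadjoint phi L.
Proof.
move=> hg hL x y; move: x; apply: eigen_basis_ind => [|D hD i j].
  split=> [|a x1 x2 h1 h2]; first by rewrite linear0 !(sesqui0l sh).
  by rewrite linearP !sh.1 h1 h2.
move: y; apply: eigen_basis_ind => [|E hE k l].
  split=> [|a x1 x2 h1 h2]; first by rewrite linear0 !(sesqui0r sh).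
  by rewrite linearP !sh.2 h1 h2.
have [_ _ _ b0 _] := hb hE.
rewrite !hL // (sesquiZl sh) (sesquiZr sh) hg //.
have [DE|DE] := pselect (D = E); last first.
  rewrite (@simple_orth _ _ _ hf uf (hform phi) D E) ?mulr0 //.
  - by move=> n' m u' v' hu hv; exact: (hform_intertwining hf uf hphi hu.1 hv).
  - exact: eigen_basis_mem.
  - exact: eigen_basis_mem.
rewrite -{E}DE in hE k l b0 *.
have [->|/(hform_eigen hD)[-> ->]//] := eqVneq (hform phi (u D i j) (u D k l)) 0.
by rewrite !mulr0.
Qed.

End EigenBasis.

(** * Uniqueness and existence of the factorization *)

Section Factorization.
Variables (K : numClosedFieldType) (H : circHopfType K) (f : H -> H -> K).
Hypotheses (hf : inner_product f) (uf : unitary (@comul K H) f).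
Variable phi : {scalar H}.
Variable Sp : {lrmorphism H -> H}.

(** With B and V the values of [beta] and [betaV] on [u], both factorizations compute S_+(u), as B u
    V and as B' u V'. Since V inverts B, the matrix V B' commutes with [u] and is a scalar. *)
Lemma decomposes_antipode_unique (beta betaV beta' betaV' : {scalar H}) :
  decomposes_antipode Sp beta betaV -> decomposes_antipode Sp beta' betaV' ->
  forall D, simple_subcoalgebra D ->
    exists2 c : K, c != 0 & forall x, D x -> beta' x = c * beta x.
Proof.
move=> [hB SB _] [hB' SB' _] D /(simple_irr hf uf)[n [u [hu iu ->]]].
have mx (s t : {scalar H}) : (forall x, conv s t x = counit x) ->
    map_mx s u *m map_mx t u = 1%:M.
  move=> st; apply/matrixP => i j; rewrite !mxE -(corep_counit _ _ hu.1) -st.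
  by rewrite (conv_corep _ _ _ _ hu.1); apply: eq_bigr => k _; rewrite !mxE.
have SE (s t : {scalar H}) : (forall x, Sp x = convl s (convr t x)) ->
    map_mx Sp u = lact (map_mx s u) (ract u (map_mx t u)).
  move=> st; have hl : map_mx (convl s) u = lact (map_mx s u) u.
    apply/matrixP => i j; rewrite !mxE (convl_corep _ _ _ hu.1).
    by apply: eq_bigr => k _; rewrite mxE.
  rewrite lact_ract -hl -map_ract.
  apply/matrixP => i j; rewrite mxE st mxE; congr convl.
  rewrite (convr_corep _ _ _ hu.1) mxE.
  by apply: eq_bigr => k _; rewrite mxE.
have BV := mx _ _ hB.1; have VB := mx _ _ hB.2.
have BV' := mx _ _ hB'.1; have VB' := mx _ _ hB'.2.
set B := map_mx beta u in BV VB; set V := map_mx betaV u in BV VB.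
set B' := map_mx beta' u in BV' VB'; set V' := map_mx betaV' u in BV' VB'.
have [c hc] : exists c, V *m B' = c%:M.
  apply: iu; have := SE _ _ SB'; rewrite (SE _ _ SB) -/B -/V -/B' -/V' => h.
  have := congr1 (fun w => lact V (ract w B')) h.
  rewrite -!lact_ract !ractA VB' ract1 !lactA VB lact1.
  by move=> ->.
have BcE : B' = c *: B by rewrite -mul_mx_scalar -hc mulmxA BV mul1mx.
exists c.
  apply/eqP => c0; move: BV'; rewrite BcE c0 scale0r mul0mx.
  move/matrixP/(_ ord0 ord0); rewrite !mxE => /esym/eqP.
  by rewrite oner_eq0.
pose P : set H := fun x => beta' x = c * beta x.
move=> x; apply: (@mxspan_min _ _ _ u P) => [|i j]; rewrite /P.
  split=> [|a y z hy hz]; first by rewrite !linear0 mulr0.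
  by rewrite !linearP /= hy hz mulrDr mulrCA.
by have /matrixP/(_ i j) := BcE; rewrite !mxE.
Qed.

Hypothesis hphi : normal_integral phi.
Hypothesis hSp : positive_antipode phi Sp.

(** <M x, x> = <L x, L x>, and [L x] is nonzero because [L] is injective. *)
Lemma positive_square (L L' M : {linear H -> H}) :
  (forall x, x != 0 -> 0 < hform phi x x) -> selfadjoint phi L ->
  cancel L L' -> (forall x, M x = L (L x)) -> positive_op phi M.
Proof.
move=> h0 sL LK ML; split=> [x y|x x0]; first by rewrite !ML !sL.
rewrite ML sL; apply: h0; apply: contra_neq x0 => e.
by rewrite -[x]LK e linear0.
Qed.

Lemma decomposes_antipode_exists : exists beta betaV : {scalar H},
  decomposes_antipode Sp beta betaV /\
  [/\
   (forall x, beta x = beta (Sp x)) /\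
   (forall x, betaV x = betaV (Sp x)),
   forall x, beta x = (beta (circ x))^*,
   [/\ selfadjoint phi (convl beta), selfadjoint phi (convr betaV),
       forall x, convl beta (convr betaV x) = convr betaV (convl beta x)
     & forall D : set H, simple_subcoalgebra D ->
         forall x, D x -> D (convl beta x) /\ D (convr betaV x)]
   & positive_op phi (convl beta) /\ positive_op phi (convr betaV)].
Proof.
have [n [u [b hb]]] := eigen_basis_exists hf uf hphi hSp.
have ds := diag_scalar_exists hf uf hb.
have [s hs] := ds (fun a => a); have [sV hsV] := ds (fun a => a^-1).
(* Square roots of [s] and [sV], from which the positivity of their operators will follow. *)
have [r hr] := ds sqrtC; have [rV hrV] := ds (fun a => (sqrtC a)^-1).
have cl := convl_diag hb; have cr := convr_diag hb.
have eqL := eq_on_basis hf uf hb; have eqS := eq_scalar_on_basis hf uf hb.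
have b0 D (hD : simple_subcoalgebra D) i : 0 < b D i.
  by have [_ _ _] := hb D hD.
have bn0 D (hD : simple_subcoalgebra D) i : b D i != 0 by rewrite gt_eqF ?b0.
have rn0 D (hD : simple_subcoalgebra D) i : sqrtC (b D i) != 0.
  by rewrite sqrtC_eq0 bn0.
have SpE D (hD : simple_subcoalgebra D) i j :
  Sp (u D i j) = (b D i / b D j) *: u D i j by have [_ _ _ _] := hb D hD.
have clr w1 w2 s1 s2 : diag_scalar u b w1 s1 -> diag_scalar u b w2 s2 ->
    forall D, simple_subcoalgebra D -> forall i j,
    convl s1 (convr s2 (u D i j)) = (w1 (b D i) * w2 (b D j)) *: u D i j.
  move=> h1 h2 D hD i j.
  by rewrite (cr _ _ h2) // [convl _ _]linearZ /= (cl _ _ h1) // scalerA mulrC.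
have hsq : diag_scalar u b (fun a => a * a) (conv s s) := conv_diag hb hs hs.
have hsqV : diag_scalar u b (fun a => a^-1 * a^-1) (conv sV sV) :=
  conv_diag hb hsV hsV.
(* [N] is the square root of S_+, and [M] below is its inverse. *)
have [N NE] : exists N : {linear H -> H}, forall D, simple_subcoalgebra D ->
    forall i j, N (u D i j) = (sqrtC (b D i) / sqrtC (b D j)) *: u D i j.
  by exists (convl r \o convr rV); exact: (clr _ _ _ _ hr hrV).
have [M ME] : exists M : {linear H -> H}, forall D, simple_subcoalgebra D ->
    forall i j, M (u D i j) = ((sqrtC (b D i))^-1 * sqrtC (b D j)) *: u D i j.
  by exists (convl rV \o convr r); exact: (clr _ _ _ _ hrV hr).
have Spr : Sp =1 N \o N.
  apply: eqL => D hD i j; rewrite /= SpE // NE // linearZ /= NE // scalerA.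
  by rewrite mulrACA -invfM -!expr2 !sqrtCK.
have NM : cancel M N.
  suff h : N \o M =1 idfun by exact: h.
  apply: eqL => D hD i j; rewrite /= ME // linearZ /= NE // scalerA.
  by rewrite mulrACA mulVf ?mulfV ?rn0 // mulr1 scale1r.
have rreal a : 0 < a -> (sqrtC a)^* = sqrtC a :> K.
  by move=> a0; rewrite geC0_conj // sqrtC_ge0 ltW.
have rVreal a : 0 < a -> ((sqrtC a)^-1)^* = (sqrtC a)^-1 :> K.
  by move=> a0; rewrite geC0_conj // invr_ge0 sqrtC_ge0 ltW.
have sadj := diag_selfadjoint hf uf hphi hSp hb.
have sN : selfadjoint phi N.
  apply: (sadj (fun a c => sqrtC a / sqrtC c)) => // a c a0 c0.
  by rewrite rmorphM /= rreal // rVreal.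
(* For z = M y, <y, y> = <N z, N z> = <S_+ z, z>. *)
have hpos y : y != 0 -> 0 < hform phi y y.
  move=> y0; have [_ _ [_ Spos] _] := hSp.
  have z0 : M y != 0 by apply: contra_neq y0 => e; rewrite -[y]NM e linear0.
  by have := Spos _ z0; rewrite Spr [(_ \o _) _]/= sN !NM.
have srl : selfadjoint phi (convl r).
  apply: (sadj (fun a _ => sqrtC a)) => [a c a0 _|D hD i j]; first exact: rreal.
  exact: (cl _ _ hr).
have srr : selfadjoint phi (convr rV).
  apply: (sadj (fun _ c => (sqrtC c)^-1)) => [a c _ c0|D hD i j].
    exact: rVreal.
  exact: (cr _ _ hrV).
have pl : positive_op phi (convl s).
  apply: (positive_square (L := convl r) (L' := convl rV)) => // x.
    suff h : (convl rV \o convl r) =1 idfun by exact: h.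
    apply: eqL => D hD i j.
    rewrite /= (cl _ _ hr) // [convl _ _]linearZ /= (cl _ _ hrV) // scalerA.
    by rewrite mulfV ?rn0 // scale1r.
  suff h : (convl s) =1 (convl r \o convl r) by exact: h.
  apply: eqL => D hD i j.
  rewrite /= (cl _ _ hr) // [convl r (_ *: _)]linearZ /= (cl _ _ hr) // scalerA.
  by rewrite (cl _ _ hs) // -expr2 sqrtCK.
have pr : positive_op phi (convr sV).
  apply: (positive_square (L := convr rV) (L' := convr r)) => // x.
    suff h : (convr r \o convr rV) =1 idfun by exact: h.
    apply: eqL => D hD i j.
    rewrite /= (cr _ _ hrV) // [convr _ _]linearZ /= (cr _ _ hr) // scalerA.
    by rewrite mulVf ?rn0 // scale1r.
  suff h : (convr sV) =1 (convr rV \o convr rV) by exact: h.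
  apply: eqL => D hD i j.
  rewrite /= (cr _ _ hrV) // [convr rV (_ *: _)]linearZ /= (cr _ _ hrV) // scalerA.
  by rewrite (cr _ _ hsV) // -invfM -expr2 sqrtCK.
(* [t] vanishes off the diagonal entries, and S_+ fixes those because b_i / b_i = 1. *)
have invSp w t : diag_scalar u b w t -> forall x, t x = t (Sp x).
  move=> ht x; symmetry.
  suff h : t \o Sp =1 t by exact: h.
  apply: eqS => D hD i j; rewrite /= SpE // linearZ /= ht //.
  by case: eqP => [->|_]; rewrite ?mulr0 // divff ?bn0 // mul1r.
have cinv w1 w2 s1 s2 : diag_scalar u b w1 s1 -> diag_scalar u b w2 s2 ->
    (forall a, 0 < a -> w1 a * w2 a = 1) ->
    forall x, conv s1 s2 x = counit x.
  move=> h1 h2 hw; suff h : conv s1 s2 =1 counit by exact: h.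
  apply: eqS => D hD i j; have [hu _ _ _ _] := hb D hD.
  by rewrite (conv_diag hb h1 h2) // hw ?b0 // (corep_counit _ _ hu.1).
exists s, sV; split; split.
- split; [apply: (cinv _ _ _ _ hs hsV)|apply: (cinv _ _ _ _ hsV hs)] => a a0.
    by rewrite divff // gt_eqF.
  by rewrite mulVf // gt_eqF.
- suff h : Sp =1 (convl s \o convr sV) by exact: h.
  apply: eqL => D hD i j.
  by rewrite /= SpE // (clr _ _ _ _ hs hsV).
- have [_ _ _ SS] := hSp => x; rewrite -SS.
  suff h : (Sp \o Sp) =1 (convl (conv s s) \o convr (conv sV sV)) by exact: h.
  apply: eqL => D hD i j.
  rewrite /= SpE // linearZ /= SpE // scalerA (clr _ _ _ _ hsq hsqV) //.
  by rewrite mulrACA.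
- by split; apply: invSp; eassumption.
- apply: (eigen_basis_ind hf uf hb) => [|D hD i j].
    split=> [|a x y hx hy].
      have c0 : circ (0 : H) = 0.
        by apply: (@addrI _ (circ 0)); rewrite -circD !addr0.
      by rewrite c0 !linear0 conjC0.
    by rewrite circD circZ !linearP rmorphD rmorphM /= conjCK hx hy.
  (* The involution exchanges u_ij and u_ji, while [s] is diagonal with real values. *)
  have [hu _ _ _ _] := hb D hD; rewrite (ucorep_circ _ _ hu) !hs // eq_sym.
  case: eqP => [->|_]; last by rewrite conjC0.
  by rewrite mulr1n geC0_conj // ltW // b0.
- split=> [| |x|D hD x Dx]; [by case: pl|by case: pr| |].
    suff h : (convl s \o convr sV) =1 (convr sV \o convl s) by exact: h.
    apply: eqL => D hD i j.
    rewrite /= (clr _ _ _ _ hs hsV) // (cl _ _ hs) // [convr _ _]linearZ /=.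
    by rewrite (cr _ _ hsV) // scalerA.
  have [hD' _ _] := hD.
  by split; [exact: subcoalgebra_convl|exact: subcoalgebra_convr].
- by [].
Qed.

End Factorization.

Theorem theorem8p7 (R : realType) (H : cqgType R[i]) (phi : {scalar H})
    (Sp : {lrmorphism H -> H})
    (hphi : normal_integral phi) (hSp : positive_antipode phi Sp) :
  [/\ exists beta betaV : {scalar H}, decomposes_antipode Sp beta betaV,
      forall beta betaV beta' betaV' : {scalar H},
        decomposes_antipode Sp beta betaV ->
        decomposes_antipode Sp beta' betaV' ->
        forall D : set H, simple_subcoalgebra D ->
          exists2 c : R[i], c != 0 & forall x, D x -> beta' x = c * beta x
    & exists beta betaV : {scalar H},
        decomposes_antipode Sp beta betaV /\
        [/\
         (forall x, beta x = beta (Sp x)) /\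
         (forall x, betaV x = betaV (Sp x)),
         forall x, beta x = (beta (circ x))^*,
         [/\ selfadjoint phi (convl beta), selfadjoint phi (convr betaV),
             forall x, convl beta (convr betaV x) = convr betaV (convl beta x)
           & forall D : set H, simple_subcoalgebra D ->
               forall x, D x -> D (convl beta x) /\ D (convr betaV x)]
         & positive_op phi (convl beta) /\ positive_op phi (convr betaV)]].
Proof.
have [f [hf uf]] := @unitarizable _ H H comul (conj (@comulA _ H) (@counitr _ H)).
split.
- have [beta [betaV [h _]]] := decomposes_antipode_exists hf uf hphi hSp.
  by exists beta, betaV.
- move=> beta betaV beta' betaV' h h' D hD.
  exact: (decomposes_antipode_unique hf uf h h' hD).
- exact: (decomposes_antipode_exists hf uf hphi hSp).
Qed.
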